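(* Fix $q\in(0,1)$ and let $\Gamma_n=K_{a_n,b_n}$ be the complete bipartite graph with parts of sizes $1\le a_n\le b_n$, $a_n+b_n\le n$. If $Q_n=o\left(\frac{n^2}{a_nb_n}\right)$, then weak detection is impossible with query budget $Q_n$. Furthermore: (1) There exist constants $C_1,C_2>0$ depending only on $q$ such that, if $m=\left\lceil C_1\frac{n^2}{b_n^2}\log n\right\rceil$ satisfies $m\le n/2$ and $(a_n+b_n)\,m/n\ge10\log n$, then $$Q_n\ge C_2\frac{n^3}{a_nb_n^2}\log^2n$$ implies that strong detection is possible with query budget $Q_n$. (2) For every fixed $\rho<\infty$ there exist constants $C_0,C_3>0$ depending only on $q$ and $\rho$ such that, if $b_n\le\rho a_n$ and $a_n\ge C_0\log n$ for all sufficiently large $n$, then $$Q_n\ge C_3\frac{n^2}{a_nb_n}\log^4n$$ implies that strong detection is possible with query budget $Q_n$ via the witness scan test (for some choice of witness $H_n\subseteq\Gamma_n$).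
   Context: Setup. Under $\mathcal H_0$, $G$ is a random graph on $[n]=\{1,\dots,n\}$ in which each pair in $\binom{[n]}{2}$ is an edge independently with probability $q$. Under $\mathcal H_1$, a copy $\Gamma_n^\star$ is drawn uniformly from the set of all subgraphs of the complete graph on $[n]$ isomorphic to $\Gamma_n$; all edges of $\Gamma_n^\star$ are in $G$, and every other pair is an edge independently with probability $q$. For a query set $\mathcal Q\subseteq\binom{[n]}{2}$ (chosen non-adaptively), the transcript is $G_{\mathcal Q}=(\mathbf 1\{e\in e(G)\})_{e\in\mathcal Q}$, with laws $\mathbb P_{\mathcal H_0,\mathcal Q}$, $\mathbb P_{\mathcal H_1,\mathcal Q}$. The optimal risk under budget $Q_n$ is $R^\star_{n,Q_n}=1-\sup_{|\mathcal Q|\le Q_n} d_{\mathrm{TV}}(\mathbb P_{\mathcal H_1,\mathcal Q},\mathbb P_{\mathcal H_0,\mathcal Q})$. Weak detection is impossible with budget $Q_n$ if $\lim_nR^\star_{n,Q_n}=1$. Strong detection is possible with budget $Q_n$ if there are (possibly random, independent of $G$) query sets $\mathcal Q_n$ with $|\mathcal Q_n|\le Q_n$ and tests based on $G_{\mathcal Q_n}$ whose sum of type-I and type-II error probabilities tends to $0$. Witness scan test with a vertex sample of size $M\le n$, $\binom M2\le Q_n$, and witness graph $H$: sample $S\subseteq[n]$ uniformly among subsets of size $M$ independently of $G$, query all pairs inside $S$, and output $1$ if and only if the induced graph $G_S$ contains a copy of $H$ as a subgraph. *)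

(* Defs.v *)
From mathcomp Require Import all_boot all_order all_algebra.
From mathcomp Require Import all_classical all_reals all_analysis.

Set Implicit Arguments.
Unset Strict Implicit.
Unset Printing Implicit Defensive.

Import Order.TTheory GRing.Theory Num.Theory.
Import numFieldNormedType.Exports.

Local Open Scope ring_scope.

(* A graph living inside an ambient finite type T is a pair (vertices, edges),
   an edge being a two-element set of vertices. *)
Notation vegraph T := ({set T} * {set {set T}})%type.

Definition pairs (T : finType) (S : {set T}) : {set {set T}} :=
  [set e : {set T} | (e \subset S) && (#|e| == 2)%N].

Definition is_graph (T : finType) (g : vegraph T) : bool :=
  g.2 \subset pairs g.1.

Definition subgraph (T : finType) (h g : vegraph T) : bool :=
  [&& is_graph h, h.1 \subset g.1 & h.2 \subset g.2].

Definition isomorphic (T U : finType) (g : vegraph T) (h : vegraph U) : bool :=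
  [exists f : {ffun T -> U},
    [&& dinjectiveb f (mem g.1), f @: g.1 == h.1
      & [set f @: (e : {set T}) | e in g.2] == h.2]].

Definition complete_graph (n : nat) : vegraph 'I_n :=
  ([set: 'I_n], pairs [set: 'I_n]).

Definition complete_bipartite (a b : nat) : vegraph ('I_a + 'I_b)%type :=
  ([set: ('I_a + 'I_b)%type],
   [set [set inl x; inr y] | x : 'I_a, y : 'I_b]).

Definition copies (n : nat) (T : finType) (g : vegraph T) : {set vegraph 'I_n} :=
  [set h : vegraph 'I_n | subgraph h (complete_graph n) && isomorphic g h].

(* Laws of random graphs on 'I_n are mass functions of the edge set. *)

(* Each pair e is an edge independently with probability p e. *)
Definition edge_law (R : realType) (n : nat) (p : {set 'I_n} -> R)
    (G : {set {set 'I_n}}) : R :=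
  (G \subset pairs [set: 'I_n])%:R *
  \prod_(e in pairs [set: 'I_n]) (if e \in G then p e else 1 - p e).

Definition null_law (R : realType) (n : nat) (q : R) :
    {set {set 'I_n}} -> R :=
  edge_law (fun=> q).

Definition planted_law (R : realType) (n : nat) (q : R) (T : finType)
    (g : vegraph T) (G : {set {set 'I_n}}) : R :=
  #|copies n g|%:R^-1 *
  \sum_(h in copies n g) edge_law (fun e => if e \in h.2 then 1 else q) G.

(* For a known query set Q, the transcript (1{e \in G})_(e in Q) is encoded as
   the set G :&: Q of queried pairs answered positively. *)
Definition transcript_law (R : realType) (n : nat) (P : {set {set 'I_n}} -> R)
    (Q t : {set {set 'I_n}}) : R :=
  \sum_(G | G :&: Q == t) P G.

Definition dTV (R : realType) (T : finType) (P1 P2 : T -> R) : R :=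
  2^-1 * \sum_(t : T) `|P1 t - P2 t|.

(* The maximum is over nonnegative values and a nonempty index set (set0 is
   always allowed), so the default value 0 plays no role. *)
Definition opt_risk (R : realType) (n : nat) (q : R) (T : finType)
    (g : vegraph T) (k : nat) : R :=
  1 - \big[Num.max/0]_(Q : {set {set 'I_n}} |
         (Q \subset pairs [set: 'I_n]) && (#|Q| <= k)%N)
        dTV (transcript_law (planted_law q g) Q)
            (transcript_law (null_law q) Q).

Definition weak_detection_impossible (R : realType) (q : R)
    (T : nat -> finType) (g : forall n, vegraph (T n)) (Q : nat -> nat) : Prop :=
  (opt_risk n q (g n) (Q n) @[n --> \oo] --> (1 : R))%classic.

(* A randomized non-adaptive procedure: the seed is drawn independently of G
   and determines the query set and the test applied to the transcript. *)
Record procedure (R : realType) (n : nat) := Procedure {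
  seed : finType;
  seed_law : seed -> R;
  query : seed -> {set {set 'I_n}};
  test : seed -> {set {set 'I_n}} -> bool }.

Definition within_budget (R : realType) (n : nat) (k : nat)
    (d : procedure R n) : Prop :=
  [/\ forall s, 0 <= seed_law (p := d) s,
      \sum_s seed_law (p := d) s = 1 &
      forall s, seed_law (p := d) s != 0 ->
        (query s \subset pairs [set: 'I_n]) && (#|query s| <= k)%N].

Definition prob_output (R : realType) (n : nat) (d : procedure R n)
    (P : {set {set 'I_n}} -> R) (c : bool) : R :=
  \sum_s seed_law (p := d) s * \sum_(G | test s (G :&: query s) == c) P G.

Definition error_sum (R : realType) (n : nat) (q : R) (T : finType)
    (g : vegraph T) (d : procedure R n) : R :=
  prob_output d (null_law q) true + prob_output d (planted_law q g) false.

Definition strongly_detects (R : realType) (q : R) (T : nat -> finType)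
    (g : forall n, vegraph (T n)) (Q : nat -> nat)
    (d : forall n, procedure R n) : Prop :=
  (forall n, within_budget (Q n) (d n)) /\
  (error_sum q (g n) (d n) @[n --> \oo] --> (0 : R))%classic.

Definition strong_detection_possible (R : realType) (q : R)
    (T : nat -> finType) (g : forall n, vegraph (T n)) (Q : nat -> nat) : Prop :=
  exists d : forall n, procedure R n, strongly_detects q g Q d.

(* The test receives the edge set t of the induced graph G_S. *)
Definition witness_scan (R : realType) (n M : nat) (T : finType)
    (h : vegraph T) : procedure R n :=
  @Procedure R n {set 'I_n}
    (fun S => (#|S| == M)%N%:R / 'C(n, M)%:R)
    (fun S => pairs S)
    (fun S t => [exists c in copies n h, subgraph c (S, t)]).

Definition strong_detection_by_witness_scan (R : realType) (q : R)
    (T : nat -> finType) (g : forall n, vegraph (T n)) (Q : nat -> nat) : Prop :=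
  exists (M : nat -> nat) (h : forall n, vegraph (T n)),
    (forall n, [/\ (M n <= n)%N, ('C(M n, 2) <= Q n)%N
                 & subgraph (h n) (g n)]) /\
    strongly_detects q g Q (fun n => witness_scan R n (M n) (h n)).

(* Main.v *)
(* A transcript has the same law under both hypotheses given that the planted
   copy misses the query set Q; by symmetry a given pair is planted with
   probability ab / C(n,2), so the total variation is at most |Q| ab / C(n,2).

   (1) Query all pairs between random vertex sets U and S of sizes
   (n/a) log n and m.  With high probability U meets the side of size a and S
   contains at least bm/(2n) vertices of the other side, which raises the
   degree into S of any planted vertex of U by a multiple of
   bm/n ~ sqrt(m log n), beyond the fluctuations of the n null degrees.

   (2) Scan for H = K_{s,s} with s ~ 3 log n / log(1/q): there are at most
   n^(2s) copies, each present with probability q^(s^2), so the null graph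
   contains none, while a sample of size ~ (n/a) log n meets both sides of the
   planted copy in at least s vertices.

   Sample intersections are controlled by Chebyshev's inequality. *)

Require Import Defs.
From mathcomp Require Import all_boot all_order all_algebra.
From mathcomp Require Import fingroup perm zify ring lra.
From mathcomp Require Import all_classical all_reals all_analysis.
(* Imported again so that names such as [subsetP] refer to finite sets. *)
From mathcomp Require Import fintype finset binomial.

Set Implicit Arguments.
Unset Strict Implicit.
Unset Printing Implicit Defensive.

Import Order.TTheory GRing.Theory Num.Theory.
Import numFieldNormedType.Exports.

Local Open Scope ring_scope.

(** * Copies of complete bipartite graphs *)

Definition cross (T : finType) (A B : {set T}) : {set {set T}} :=
  [set [set x; y] | x in A, y in B].

Definition bip (T : finType) (A B : {set T}) : vegraph T :=
  (A :|: B, cross A B).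

Lemma complete_bipartiteE (a b : nat) :
  complete_bipartite a b =
  bip [set inl x | x : 'I_a] [set inr y | y : 'I_b].
Proof.
congr pair.
  apply/setP => -[x|y]; rewrite !inE.
    by rewrite imset_f.
  by rewrite orbC imset_f.
apply/setP => e; apply/imset2P/imset2P => [[x y _ _ ->]|[x y]].
  by exists (inl x) (inr y) => //; rewrite imset_f.
by move=> /imsetP[x' _ ->] /imsetP[y' _ ->] ->; exists x' y'.
Qed.

Lemma disjoint_inl_inr (a b : nat) :
  [disjoint [set inl x | x : 'I_a] & ([set inr y | y : 'I_b] :
    {set 'I_a + 'I_b})].
Proof.
apply/pred0P => -[x|y] /=; apply/negbTE/negP => /andP[].
  by move=> _ /imsetP[].
by move=> /imsetP[].
Qed.

Lemma disjoint_neq (T : finType) (A B : {set T}) x y :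
  [disjoint A & B] -> x \in A -> y \in B -> x != y.
Proof.
by move=> dAB xA yB; apply: contraTneq yB => <-; rewrite (disjointFr dAB).
Qed.

(** Disjointness makes an unordered pair remember which endpoint lies in [A], so [(x, y)] can be
    recovered from it. *)
Lemma card_cross (T : finType) (A B : {set T}) :
  [disjoint A & B] -> #|cross A B| = (#|A| * #|B|)%N.
Proof.
move=> dAB; rewrite /cross curry_imset2X card_in_imset ?cardsX //.
move=> [x y] [x' y'] /setXP[/= xA yB] /setXP[/= x'A y'B] /setP eq_e.
have := eq_e x; rewrite !inE eqxx /= => /esym/orP[/eqP exx'|/eqP exy'].
  have := eq_e y; rewrite !inE eqxx orbT => /esym/orP[/eqP eyx'|/eqP ->].
    by have /eqP := disjoint_neq dAB x'A yB; rewrite eyx'.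
  by rewrite exx'.
by have /eqP := disjoint_neq dAB xA y'B.
Qed.

Lemma cross_pairs (T : finType) (A B : {set T}) :
  [disjoint A & B] -> cross A B \subset pairs (A :|: B).
Proof.
move=> dAB; apply/subsetP => _ /imset2P[x y xA yB ->].
rewrite inE subUset !sub1set !inE xA yB orbT /=.
by rewrite cards2 (disjoint_neq dAB xA yB).
Qed.

Lemma crossS (T : finType) (A B C D : {set T}) :
  A \subset C -> B \subset D -> cross A B \subset cross C D.
Proof.
move=> /subsetP AC /subsetP BD.
apply/subsetP => _ /imset2P[x y /AC xC /BD yD ->].
by apply/imset2P; exists x y.
Qed.

Lemma imset_cross (T U : finType) (f : T -> U) (A B : {set T}) :
  [set f @: (e : {set T}) | e in cross A B] = cross (f @: A) (f @: B).
Proof.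
apply/setP => e; apply/imsetP/imset2P.
  move=> [_ /imset2P[x y xA yB ->] ->]; exists (f x) (f y); rewrite ?imset_f //.
  by rewrite imsetU1 imset_set1.
move=> [_ _ /imsetP[x xA ->] /imsetP[y yB ->] ->].
exists [set x; y]; last by rewrite imsetU1 imset_set1.
by apply/imset2P; exists x y.
Qed.

Lemma card_eq_imset (T U : finType) (u0 : U) (A : {set T}) (B : {set U}) :
  #|A| = #|B| -> exists2 f : T -> U, {in A &, injective f} & f @: A = B.
Proof.
(* Match the enumerations of [A] and [B] position by position; the default [u0] is reached only
   outside [A]. *)
move=> cAB; pose f x := nth u0 (enum B) (index x (enum A)).
have idx x : x \in A -> (index x (enum A) < size (enum B))%N.
  by move=> xA; rewrite -cardE -cAB cardE index_mem mem_enum.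
have finj : {in A &, injective f}.
  move=> x y xA yA /eqP; rewrite nth_uniq ?idx ?enum_uniq // => /eqP eqi.
  by rewrite -(nth_index x (s := enum A) (x := x)) ?mem_enum //
    eqi nth_index ?mem_enum.
exists f => //; apply/eqP; rewrite eqEcard card_in_imset // cAB leqnn andbT.
apply/subsetP => _ /imsetP[x xA ->].
by rewrite -(mem_enum (mem B)) mem_nth ?idx.
Qed.

(** Replaces an abstract isomorphism by the images of the two sides, which inherit sizes and
    disjointness from injectivity on [A :|: B]. *)
Lemma mem_copies_bip (n : nat) (T : finType) (A B : {set T}) (c :
  vegraph 'I_n) :
  [disjoint A & B] -> c \in copies n (bip A B) ->
  exists U V : {set 'I_n}, [/\ [disjoint U & V], #|U| = #|A|, #|V| = #|B| &
    c = bip U V].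
Proof.
move=> dAB; rewrite inE => /andP[_ /existsP[f /and3P[/dinjectiveP fi /eqP f1 /eqP f2]]].
exists (f @: A), (f @: B); split.
- apply/pred0P => u /=; apply/negbTE/negP => /andP[/imsetP[x xA ->] /imsetP[y yB]].
  move=> /fi; rewrite !inE xA yB orbT => /(_ isT isT) exy.
  by have := disjoint_neq dAB xA yB; rewrite exy eqxx.
- by rewrite card_in_imset // => x y xA yA; apply: fi; rewrite inE /= ?xA ?yA.
- by rewrite card_in_imset // => x y xA yA; apply: fi;
    rewrite inE /= ?xA ?yA ?orbT.
- by case: c f1 f2 => c1 c2 /= <- <-; rewrite imset_cross imsetU.
Qed.

(** Converse of [mem_copies_bip]: bijections from [A] to [U] and from [B] to [V] are glued along the
    disjoint sides. *)
Lemma bip_copies (n : nat) (T : finType) (A B : {set T}) (U V : {set 'I_n}) :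
  (0 < n)%N -> [disjoint A & B] -> [disjoint U & V] -> #|U| = #|A| ->
    #|V| = #|B| ->
  bip U V \in copies n (bip A B).
Proof.
move=> n_gt0 dAB dUV cU cV.
have UVT : cross U V \subset pairs [set: 'I_n].
  rewrite (subset_trans (cross_pairs dUV)) //.
  by apply/subsetP => e; rewrite !inE subsetT => /andP[].
rewrite inE /subgraph /is_graph /= cross_pairs // subsetT UVT /=.
pose u0 := Ordinal n_gt0.
have [f fi fA] := card_eq_imset u0 (esym cU).
have [g gi gB] := card_eq_imset u0 (esym cV).
pose h : {ffun T -> 'I_n} := [ffun x => if x \in A then f x else g x].
have hA x : x \in A -> h x = f x by rewrite ffunE => ->.
have hB x : x \in B -> h x = g x.
  by move=> xB; rewrite ffunE ifN // (disjointFl dAB).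
have hfA : h @: A = U by rewrite -fA; apply: eq_in_imset.
have hgB : h @: B = V by rewrite -gB; apply: eq_in_imset.
apply/existsP; exists h; rewrite imset_cross imsetU hfA hgB !eqxx !andbT.
have hUV x y : x \in A -> y \in B -> h x <> h y.
  move=> xA yB; apply/eqP; apply: (disjoint_neq dUV).
    by rewrite -hfA imset_f.
  by rewrite -hgB imset_f.
apply/dinjectiveP => x y; rewrite !inE => /orP[xA|xB] /orP[yA|yB].
- by rewrite !hA //; apply: fi.
- by move/(hUV _ _ xA yB).
- by move/esym/(hUV _ _ yA xB).
- by rewrite !hB //; apply: gi.
Qed.

Lemma exists_subset_card (T : finType) (A : {set T}) (k : nat) :
  (k <= #|A|)%N ->
  exists2 B : {set T}, B \subset A & #|B| = k.
Proof.
move=> kA; have : (0 < #|[set B : {set T} | B \subset A & #|B| == k]|)%N.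
  by rewrite cards_draws bin_gt0.
by case/card_gt0P => B; rewrite inE => /andP[sB /eqP cB]; exists B.
Qed.

(** * Product laws on edge sets *)

Section EdgeLaw.
Variables (R : realType) (n : nat).
Implicit Types (p : {set 'I_n} -> R) (G D Q t : {set {set 'I_n}}).

Local Notation allpairs := (pairs [set: 'I_n]).

Lemma edge_law_ge0 p G : (forall e, 0 <= p e <= 1) -> 0 <= edge_law p G.
Proof.
move=> p01; rewrite mulr_ge0 //; apply: prodr_ge0 => e _.
by case: ifP; have /andP[] := p01 e => //; rewrite subr_ge0.
Qed.

(** Independence as a product formula; the event probabilities and the moment generating function
    below are instances of it. *)
Lemma sum_edge_law_prod p (F : {set 'I_n} -> bool -> R) :
  \sum_G edge_law p G * \prod_(e in allpairs) F e (e \in G) =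
  \prod_(e in allpairs) (p e * F e true + (1 - p e) * F e false).
Proof.
rewrite [RHS]big_mkcond /=.
(* Outside [allpairs] the factor 1 is split as 0 + 1, so that expanding the product over all [G]
   kills every [G] with an element that is not a pair. *)
rewrite [RHS](eq_bigr (fun e => (if e \in allpairs then p e * F e true else 0) +
    (if e \in allpairs then (1 - p e) * F e false else 1))); last first.
  by move=> e _; case: ifP => // _; rewrite add0r.
rewrite bigA_distr; apply: eq_bigr => G _.
rewrite /edge_law; case: (boolP (G \subset _)) => [sG|/subsetPn[e eG eP]].
  rewrite mul1r -big_split big_mkcond /=; apply: eq_bigr => e _.
  case: (boolP (e \in G)) => eG; first by rewrite (subsetP sG).
  by case: ifP.
by rewrite !mul0r (bigD1 e) //= eG (negbTE eP) mul0r.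
Qed.

Lemma sum_edge_law p : \sum_G edge_law p G = 1.
Proof.
transitivity (\sum_G edge_law p G * \prod_(e in allpairs) (1 : R)).
  by apply: eq_bigr => G _; rewrite big1_eq mulr1.
rewrite (sum_edge_law_prod p (fun _ _ => 1)) big1 // => e _.
by rewrite !mulr1 subrKC.
Qed.

Lemma sum_edge_law_event p (A : {set 'I_n} -> bool -> bool) :
  \sum_(G : {set {set 'I_n}} | [forall e in allpairs,
    A e (e \in G)]) edge_law p G =
  \prod_(e in allpairs)
    (p e * (A e true)%:R + (1 - p e) * (A e false)%:R).
Proof.
rewrite -(sum_edge_law_prod p (fun e b => (A e b)%:R)) big_mkcond.
apply: eq_bigr => G _; case: ifPn => [/forall_inP AG|].
  by rewrite big1 ?mulr1 // => e /AG ->.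
by rewrite negb_forall_in => /exists_inP[e eP /negbTE Ae];
  rewrite (bigD1 e) //= Ae mul0r mulr0.
Qed.

Lemma sum_edge_law_sup p D : D \subset allpairs ->
  \sum_(G : {set {set 'I_n}} | D \subset G) edge_law p G = \prod_(e in D) p e.
Proof.
move=> /subsetP sD.
have := sum_edge_law_event p (fun e b => (e \in D) ==> b).
rewrite [X in _ = X]big_mkcond [X in _ -> _ = X]big_mkcond /= => eqS.
transitivity (\sum_(G : {set {set 'I_n}} | [forall e in allpairs,
  (e \in D) ==> (e \in G)])
  edge_law p G).
  apply: eq_bigl => G; apply/subsetP/forall_inP => [DG e _|DG e eD].
    by apply/implyP/DG.
  by move: (DG e (sD e eD)); rewrite eD.
rewrite eqS; apply: eq_bigr => e _; case: (boolP (e \in D)) => [/sD -> /=|_].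
  by rewrite mulr1 mulr0 addr0.
by case: ifP => //= _; rewrite !mulr1 subrKC.
Qed.

(** The unqueried factors sum to 1. Applied to a planted copy that misses [Q], this makes its
    transcript law equal to the null one. *)
Lemma eq_transcript_edge_law p1 p2 Q t : {in Q, p1 =1 p2} ->
  transcript_law (edge_law p1) Q t = transcript_law (edge_law p2) Q t.
Proof.
move=> p12; rewrite /transcript_law.
(* Other transcripts are unreachable and have mass 0 under both laws. *)
case: (boolP (t \subset Q :&: allpairs)) => [/subsetP st|nst]; last first.
  have z p : \sum_(G : {set {set 'I_n}} | G :&: Q == t) edge_law p G = 0.
    apply: big1 => G /eqP Gt; rewrite /edge_law; case: (boolP (_ \subset _)).
      move=> sG; case/negP: nst; rewrite -Gt subsetI subsetIr /=.
      by rewrite (subset_trans (subsetIl _ _)).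
    by rewrite mul0r.
  by rewrite !z.
have eqS p : \sum_(G : {set {set 'I_n}} | G :&: Q == t) edge_law p G =
   \prod_(e in allpairs)
    (p e * ((e \in Q) ==> (e \in t))%:R +
     (1 - p e) * ((e \in Q) ==> (e \notin t))%:R).
  have /= := sum_edge_law_event p
    (fun e b => (e \in Q) ==> (b == (e \in t))).
  rewrite [X in X = _]big_mkcond [X in _ -> X = _]big_mkcond /= => eqS.
  transitivity (\prod_(e in allpairs)
     (p e * ((e \in Q) ==> (true == (e \in t)))%:R +
     (1 - p e) * ((e \in Q) ==> (false == (e \in t)))%:R)); last first.
    by apply: eq_bigr => e _; case: (e \in t).
  rewrite -eqS; apply: eq_bigr => G _; rewrite /edge_law.
  case: (boolP (G \subset _)) => [/subsetP sG|_];
    last by rewrite !mul0r !if_same.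
  rewrite mul1r; congr (if _ then _ else _).
  apply/eqP/forall_inP => [Gt e eP|Gt].
    by rewrite -Gt inE; apply/implyP => ->; rewrite andbT.
  apply/setP => e; rewrite inE; apply/andP/idP => [[eG eQ]|et].
    by move: (Gt e (sG e eG)); rewrite eQ eG => /eqP <-.
  have /setIP[eQ eP] := st e et.
  by move: (Gt e eP); rewrite eQ et eqb_id.
rewrite !eqS; apply: eq_bigr => e _.
case: (boolP (e \in Q)) => [/p12 -> //|_].
by rewrite !mulr1 !subrKC.
Qed.

(** From [expR (- x) >= 1 - x] one gets [expR x <= (1 - x)^-1], and [(1 - x) (1 + x + 2 x^2) = 1 +
    x^2 (1 - 2 x)] is at least 1. *)
Lemma expR_le_quadratic (x : R) : `|x| <= 2^-1 -> expR x <= 1 + x + 2 * x ^+ 2.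
Proof.
rewrite ler_norml => /andP[x_ge x_le].
have := expR_ge1Dx (- x); rewrite expRN => ex.
have x1 : 0 < 1 - x by lra.
have : expR x <= (1 - x)^-1.
  by rewrite -[expR x]invrK lef_pV2 ?posrE // invr_gt0 expR_gt0.
move/le_trans; apply.
rewrite -[X in X <= _]mul1r ler_pdivrMr //.
have : 0 <= x ^+ 2 * (1 - 2 * x) by rewrite mulr_ge0 ?sqr_ge0 //; lra.
by nra.
Qed.

(** In the quadratic bound the linear terms cancel by centring, and the variance [q (1 - q)] is at
    most 1. *)
Lemma bernoulli_mgf_le (q s : R) : 0 <= q <= 1 -> `|s| <= 2^-1 ->
  q * expR (s * (1 - q)) + (1 - q) * expR (s * (0 - q)) <= expR (2 * s ^+ 2).
Proof.
move=> /andP[q0 q1] sle.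
have sc (y : R) : `|y| <= 1 -> `|s * y| <= 2^-1.
  by move=> y1; rewrite normrM (le_trans _ sle) // ler_piMr.
have := expR_le_quadratic (sc (1 - q) _); have :=
  expR_le_quadratic (sc (0 - q) _).
rewrite !ler_norml => /(_ ltac:(lra)) e0 /(_ ltac:(lra)) e1.
have := expR_ge1Dx (2 * s ^+ 2); apply: le_trans.
have : q * expR (s * (1 - q)) <= q * (1 + s * (1 - q) + 2 * (s * (1 - q)) ^+ 2).
  by rewrite ler_wpM2l.
have : (1 - q) * expR (s * (0 - q)) <=
    (1 - q) * (1 + s * (0 - q) + 2 * (s * (0 - q)) ^+ 2).
  by rewrite ler_wpM2l // subr_ge0.
have : 0 <= s ^+ 2 * (1 - q * (1 - q)) by rewrite mulr_ge0 ?sqr_ge0 //; nra.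
nra.
Qed.

(** Chernoff bound by exponential Markov; the sign of [s] selects the upper or the lower tail. Only
    the pairs of [D] must have probability [q], so it also applies to a planted law away from the
    copy. *)
Lemma edge_law_tail p (q s u : R) D : (forall e, 0 <= p e <= 1) ->
  {in D, forall e, p e = q} -> 0 <= q <= 1 ->
  D \subset allpairs -> `|s| <= 2^-1 ->
  \sum_(G : {set {set 'I_n}} | u <= s * (#|G :&: D|%:R - q * #|D|%:R)) edge_law p G <=
  expR (2 * s ^+ 2 * #|D|%:R - u).
Proof.
move=> p01 pq q01 /subsetP sD sle.
pose F e (b : bool) := if e \in D then expR (s * (b%:R - q)) else 1.
have FE G : expR (s * (#|G :&: D|%:R - q * #|D|%:R)) =
    \prod_(e in allpairs) F e (e \in G).
  have -> : s * (#|G :&: D|%:R - q * #|D|%:R) =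
      \sum_(e in D) s * ((e \in G)%:R - q).
    rewrite -mulr_sumr sumrB sumr_const mulr_natr; congr (_ * (_ - _)).
    rewrite -sumr_const big_mkcond [RHS]big_mkcond /=.
    by apply: eq_bigr => e _; rewrite inE andbC; case: (e \in D);
      case: (e \in G).
  rewrite expR_sum big_mkcond [RHS]big_mkcond /=; apply: eq_bigr => e _.
  by rewrite /F; case: ifP => [/sD ->|_] //; rewrite if_same.
have EF : \sum_G edge_law p G * \prod_(e in allpairs) F e (e \in G) <=
    expR (2 * s ^+ 2 * #|D|%:R).
  rewrite sum_edge_law_prod.
  have -> : 2 * s ^+ 2 * #|D|%:R = \sum_(e in D) 2 * s ^+ 2.
    by rewrite sumr_const mulr_natr.
  rewrite expR_sum.
  rewrite [X in _ <= X]big_mkcond [X in X <= _]big_mkcond.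
  apply: ler_prod => e _; rewrite /F; case: (boolP (e \in D)) => eD.
    rewrite (sD e eD) (pq e eD) bernoulli_mgf_le // andbT.
    by case/andP: q01 => q0 q1; rewrite addr_ge0 // mulr_ge0 ?subr_ge0 //
      expR_ge0.
  by rewrite !mulr1 subrKC if_same ler01 lexx.
rewrite expRD; apply: (le_trans _ (ler_wpM2r (expR_ge0 _) EF)).
rewrite mulr_suml big_mkcond; apply: ler_sum => G _.
rewrite -FE -mulrA -expRD.
case: ifP => [uG|_]; last by rewrite mulr_ge0 ?edge_law_ge0 ?expR_ge0.
apply: ler_peMr; first exact: edge_law_ge0.
by apply: le_trans (expR_ge1Dx _); rewrite lerDl subr_ge0.
Qed.

(** An absent pair of probability 1 annihilates the product; this turns almost sure presence of
    planted edges into plain membership. *)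
Lemma edge_law_support p G : edge_law p G != 0 ->
  G \subset allpairs /\ {in allpairs, forall e, p e = 1 -> e \in G}.
Proof.
rewrite /edge_law; case: (boolP (G \subset _)) => [sG|_];
  last by rewrite mul0r eqxx.
rewrite mul1r => nz; split => // e eP pe1; apply: contraNT nz => eG.
by rewrite (bigD1 e) //= (negbTE eG) pe1 subrr mul0r.
Qed.

End EdgeLaw.

(** * Uniform subsets of fixed size *)

Section UniformSubset.
Variables (R : realType) (n M : nat).
Hypotheses (M_gt0 : (0 < M)%N) (M_le : (M <= n)%N).
Implicit Types (S X : {set 'I_n}).

(** Adding [D] is a bijection from the subsets of the complement of [D] of size [M - #|D|]. *)
Lemma card_draws_sup (D : {set 'I_n}) : (#|D| <= M)%N ->
  #|[set S : {set 'I_n} | D \subset S & #|S| == M]| = 'C(n - #|D|, M - #|D|).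
Proof.
move=> dM; have cD : #|~: D| = (n - #|D|)%N by rewrite cardsCs setCK card_ord.
have UDK : {in [set B : {set 'I_n} | B \subset ~: D & #|B| == (M - #|D|)%N],
    cancel (fun B => D :|: B) (fun S => S :\: D)}.
  move=> B; rewrite inE => /andP[sB _].
  by rewrite setDUl setDv set0U setDE; apply/setIidPl.
rewrite -cD -cards_draws -(card_in_imset (can_in_inj UDK)).
apply: eq_card => S; rewrite inE; apply/andP/imsetP => [[sD /eqP cS]|[B + ->]].
  exists (S :\: D); last by rewrite setDE setUIr setUCr setIT (setUidPr sD).
  by rewrite inE setDE subsetIr /= -setDE cardsD (setIidPr sD) cS.
rewrite inE => /andP[sB /eqP cB]; split; first exact: subsetUl.
have DB0 : D :&: B = set0.
  by apply/eqP; rewrite setI_eq0 disjoint_sym disjoints_subset.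
by rewrite cardsU DB0 cards0 subn0 cB subnKC.
Qed.

Lemma sum_draws (P : pred {set 'I_n}) :
  \sum_(S | P S) ((#|S| == M)%:R / 'C(n, M)%:R : R) =
  #|[set S : {set 'I_n} | P S & #|S| == M]|%:R / 'C(n, M)%:R.
Proof.
rewrite -mulr_suml; congr (_ / _).
rewrite -sum1_card natr_sum big_mkcond [RHS]big_mkcond /=.
by apply: eq_bigr => S _; rewrite !inE; case: (P S); case: (_ == M).
Qed.

Lemma bin_gt0R : 0 < 'C(n, M)%:R :> R.
Proof. by rewrite ltr0n bin_gt0. Qed.

Lemma sum_draws1 : \sum_(S : {set 'I_n}) ((#|S| == M)%:R / 'C(n, M)%:R : R) = 1.
Proof.
have := sum_draws xpredT; rewrite /= => ->.
rewrite (_ : #|_| = 'C(n, M)); first by rewrite divff // gt_eqF // bin_gt0R.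
by rewrite -[in RHS](card_ord n) -card_draws; apply: eq_card => S; rewrite !inE.
Qed.

Lemma sum_draws_mem (x : 'I_n) :
  \sum_(S : {set 'I_n} | x \in S) ((#|S| == M)%:R / 'C(n, M)%:R : R) =
  M%:R / n%:R.
Proof.
rewrite (sum_draws (fun S => x \in S)).
have -> : #|[set S : {set 'I_n} | x \in S & #|S| == M]| = 'C(n - 1, M - 1).
  rewrite -(cards1 x) -card_draws_sup ?cards1 //.
  by apply: eq_card => S; rewrite !inE sub1set.
have n_gt0 : (0 < n)%N by lia.
have := mul_bin_diag n M.-1; rewrite prednK // -!subn1 => e.
apply/eqP; rewrite (eqr_div _ _ (lt0r_neq0 bin_gt0R)) ?pnatr_eq0 ?(gtn_eqF n_gt0) //.
by rewrite -!natrM mulnC e mulnC.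
Qed.

(* Membership events are negatively correlated when sampling without
   replacement, so the variance below is at most the mean. *)
Lemma sum_draws_mem2 (x y : 'I_n) : x != y ->
  \sum_(S : {set 'I_n} | (x \in S) && (y \in S))
    ((#|S| == M)%:R / 'C(n, M)%:R : R) <= (M%:R / n%:R) ^+ 2.
Proof.
move=> xy; rewrite (sum_draws (fun S => (x \in S) && (y \in S))).
have n_gt0 : (0 < n)%N by lia.
have c2 : #|[set x; y]| = 2 by rewrite cards2 xy.
have -> : #|[set S : {set 'I_n} | (x \in S) && (y \in S) & #|S| == M]| =
    #|[set S : {set 'I_n} | [set x; y] \subset S & #|S| == M]|.
  by apply: eq_card => S; rewrite !inE subUset !sub1set.
case: (ltnP M 2) => M2.
  rewrite (_ : #|_| = 0%N) ?mul0r ?sqr_ge0 //.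
  apply/eqP; rewrite cards_eq0; apply/eqP/setP => S; rewrite !inE.
  apply/negbTE/negP => /andP[/subset_leq_card]; rewrite c2 => + /eqP eM.
  by rewrite eM leqNgt M2.
rewrite card_draws_sup c2 // ler_pdivrMr ?bin_gt0R //.
have e1 := mul_bin_diag n M.-1.
have e2 := mul_bin_diag n.-1 M.-2.
rewrite expr_div_n mulrAC ler_pdivlMr ?exprn_gt0 ?ltr0n //
  -!natrX -!natrM ler_nat.
have e3 : (n * n.-1 * 'C(n - 2, M - 2) = M * M.-1 * 'C(n, M))%N.
  move: e1 e2; rewrite -!subn1 -!subnDA.
  have -> : (M - 1).+1 = M by lia.
  have -> : (M - (1 + 1)).+1 = (M - 1)%N by lia.
  by move=> e1 e2; rewrite -mulnA e2 mulnCA e1 mulnCA mulnA.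
have n1_gt0 : (0 < n.-1)%N by lia.
rewrite -(leq_pmul2r n1_gt0).
have -> : ('C(n - 2, M - 2) * n ^ 2 * n.-1 = n * (M * M.-1 * 'C(n, M)))%N.
  by rewrite -e3; lia.
(* This is where [M <= n] gives negative correlation: [(M - 1) / (n - 1) <= M / n]. *)
have : (n * M.-1 <= M * n.-1)%N by nia.
move=> h; have := leq_mul (leqnn (M * 'C(n, M))) h.
by lia.
Qed.

(** Chebyshev: the variance is at most [mu] and the deviation at least [mu / 2], whence
    [mu / (mu / 2)^2 = 4 / mu]. *)
Lemma draws_lower_tail X (mu : R) : (0 < #|X|)%N ->
  mu = #|X|%:R * M%:R / n%:R ->
  \sum_(S : {set 'I_n} | #|S :&: X|%:R <= mu / 2)
    ((#|S| == M)%:R / 'C(n, M)%:R) <= 4 / mu.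
Proof.
move=> X_gt0 muE; have n_gt0 : (0 < n)%N by lia.
have mu_gt0 : 0 < mu by rewrite muE divr_gt0 ?mulr_gt0 ?ltr0n.
pose w S : R := (#|S| == M)%:R / 'C(n, M)%:R.
have w_ge0 S : 0 <= w S by rewrite divr_ge0.
have cE S : #|S :&: X|%:R = \sum_(x in X) (x \in S)%:R :> R.
  rewrite -sum1_card natr_sum big_mkcond [RHS]big_mkcond /=.
  by apply: eq_bigr => x _; rewrite !inE andbC; case: (x \in X);
    case: (x \in S).
have m1 : \sum_S w S * #|S :&: X|%:R = mu.
  under eq_bigr => S _ do rewrite cE mulr_sumr.
  rewrite exchange_big /= (eq_bigr (fun=> M%:R / n%:R)).
    by rewrite sumr_const -[LHS]mulr_natl mulrA muE.
  move=> x _; rewrite -(sum_draws_mem x) [RHS]big_mkcond /=.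
  by apply: eq_bigr => S _; case: (x \in S); rewrite ?mulr1 ?mulr0.
have m2 : \sum_S w S * #|S :&: X|%:R ^+ 2 <= mu + mu ^+ 2.
  under eq_bigr => S _.
    rewrite cE expr2 mulr_suml mulr_sumr.
    under eq_bigr => x _ do rewrite mulr_sumr mulr_sumr.
    over.
  rewrite exchange_big /=.
  have -> : mu + mu ^+ 2 =
      \sum_(x in X) (M%:R / n%:R + \sum_(y in X) (M%:R / n%:R) ^+ 2).
    rewrite big_split /= !sumr_const muE -[X in _ = X + _]mulr_natl.
    rewrite -[X in _ = _ + X]mulr_natl -[X in _ = _ + _ * X]mulr_natl.
    by ring.
  (* The diagonal term [y = x] yields the mean; the others are bounded by [sum_draws_mem2], and one
     spare square fills the diagonal place. *)
  apply: ler_sum => x xX; rewrite exchange_big /= (bigD1 x) //=; apply: lerD.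
    rewrite -(sum_draws_mem x) [X in _ <= X]big_mkcond /=.
    by apply: ler_sum => S _; case: (x \in S); rewrite ?mulr1 ?mulr0.
  rewrite [X in _ <= X](bigD1 x) //=.
  apply: le_trans (_ : _ <= \sum_(y in X | y != x) (M%:R / n%:R) ^+ 2) _.
    apply: ler_sum => y /andP[_ yx].
    rewrite eq_sym in yx.
    apply: le_trans (sum_draws_mem2 yx); rewrite [X in _ <= X]big_mkcond /=.
    by apply: ler_sum => S _; case: (x \in S); case: (y \in S);
      rewrite ?mulr1 ?mulr0.
  by rewrite lerDr sqr_ge0.
have var : \sum_S w S * (#|S :&: X|%:R - mu) ^+ 2 <= mu.
  have -> : \sum_S w S * (#|S :&: X|%:R - mu) ^+ 2 =
     \sum_S w S * #|S :&: X|%:R ^+ 2 - 2 * mu * \sum_S w S * #|S :&: X|%:R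
     + mu ^+ 2 * \sum_S w S.
    rewrite !mulr_sumr -sumrB -big_split; apply: eq_bigr => S _ /=; ring.
  by rewrite m1 /w sum_draws1; nra.
have -> : 4 / mu = mu * (4 / mu ^+ 2).
  by rewrite expr2 invfM; field; rewrite gt_eqF.
apply: (le_trans _ (ler_wpM2r _ var)); last by rewrite divr_ge0 ?sqr_ge0.
rewrite mulr_suml big_mkcond; apply: ler_sum => S _.
case: ifP => [Sle|_]; last first.
  by rewrite mulr_ge0 ?divr_ge0 ?sqr_ge0 // mulr_ge0 ?sqr_ge0 ?w_ge0.
rewrite -mulrA ler_peMr ?w_ge0 //.
rewrite mulrA ler_pdivlMr ?exprn_gt0 // mul1r.
have : 0 <= #|S :&: X|%:R :> R by [].
by nra.
Qed.

End UniformSubset.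

(** * Impossibility *)

(** Double counting of incidences between copies and pairs: by symmetry every pair lies in equally
    many copies, and every copy has [#|A| * #|B|] edges. *)
Lemma card_copies_edge (n : nat) (T : finType) (A B : {set T}) (e :
  {set 'I_n}) :
  [disjoint A & B] -> e \in pairs [set: 'I_n] ->
  (#|[set h in copies n (bip A B) | e \in h.2]| * 'C(n, 2) =
    #|A| * #|B| * #|copies n (bip A B)|)%N.
Proof.
move=> dAB; set C := copies n _; pose N e' := #|[set h in C | e' \in h.2]|.
have Nle e1 e2 : e1 \in pairs [set: 'I_n] -> e2 \in pairs [set: 'I_n] ->
    (N e1 <= N e2)%N.
  rewrite !inE !subsetT /= => /cards2P[x [y [xy ->]]] /cards2P[x' [y' [xy' ->]]].
  (* A permutation taking [x] to [x'] and [y] to [y']: [y1] is where the first transposition leaves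
     [y], and the second one fixes [x']. *)
  pose y1 := tperm x x' y; pose s := (tperm x x' * tperm y1 y')%g.
  have sx : s x = x'.
    rewrite permM tpermL tpermD ?(eq_sym y') //.
    by rewrite /y1 -{2}(tpermL x x') (inj_eq perm_inj) eq_sym.
  have sy : s y = y' by rewrite permM tpermL.
  pose f (h : vegraph 'I_n) : vegraph 'I_n :=
    (s @: h.1, [set s @: (e' : {set 'I_n}) | e' in h.2]).
  have sinj : injective (fun E : {set 'I_n} => s @: E).
    exact: imset_inj perm_inj.
  have finj : injective f.
    by move=> [h1 h2] [k1 k2] [/sinj -> /(imset_inj sinj) ->].
  rewrite /N -(card_imset _ finj); apply/subset_leq_card/subsetP.
  move=> _ /imsetP[h + ->]; rewrite inE => /andP[hC eh]; rewrite inE;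
    apply/andP; split; last first.
    apply/imsetP; exists [set x; y] => //.
    by rewrite imsetU1 imset_set1 sx sy.
  have [U [V [dUV cU cV ->]]] := mem_copies_bip dAB hC.
  rewrite /f /= imset_cross imsetU.
  apply: bip_copies; rewrite ?(card_imset _ perm_inj) //.
    exact: leq_ltn_trans (ltn_ord x).
  rewrite -setI_eq0 -imsetI; last by move=> ? ? _ _; apply: perm_inj.
  by rewrite (disjoint_setI0 dUV) imset0.
move=> eP; have eqN e' : e' \in pairs [set: 'I_n] -> N e' = N e.
  by move=> e'P; apply/eqP; rewrite eqn_leq !Nle.
have cP : #|pairs [set: 'I_n]| = 'C(n, 2) by rewrite cards_draws cardsT card_ord.
transitivity (\sum_(e' in pairs [set: 'I_n]) N e')%N.
  by rewrite (eq_bigr (fun=> N e)) // sum_nat_const cP mulnC.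
have -> : (\sum_(e' in pairs [set: 'I_n]) N e' =
    \sum_(e' in pairs [set: 'I_n]) \sum_(h in C) (e' \in h.2))%N.
  apply: eq_bigr => e' _; rewrite /N -sum1_card big_mkcond [RHS]big_mkcond /=.
  by apply: eq_bigr => h _; rewrite inE; case: (h \in C); case: (_ \in _).
rewrite exchange_big /= (eq_bigr (fun=> #|A| * #|B|)%N) => [|h hC].
  by rewrite sum_nat_const mulnC.
have := hC; rewrite inE => /andP[/and3P[_ _ /subsetP hP] _].
have [U [V [dUV cU cV hE]]] := mem_copies_bip dAB hC.
transitivity #|h.2|; last by rewrite hE card_cross // cU cV.
rewrite -sum1_card big_mkcond [RHS]big_mkcond /=; apply: eq_bigr => e' _.
by case: (boolP (e' \in h.2)) => [/hP ->|_] //; rewrite if_same.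
Qed.

(** * Total variation between planted and null transcripts *)

Section Planted.
Variables (R : realType) (n : nat) (q : R) (T : finType) (g : vegraph T).
Hypothesis q01 : 0 <= q <= 1.

Lemma planted_prob01 (h : vegraph 'I_n) (e : {set 'I_n}) :
  0 <= (if e \in h.2 then 1 else q) <= 1.
Proof. by case: ifP; rewrite ?ler01 ?lexx. Qed.

Lemma sum_transcript (P : {set {set 'I_n}} -> R) Q :
  \sum_t transcript_law P Q t = \sum_G P G.
Proof.
by rewrite [RHS](partition_big (fun G => G :&: Q) xpredT).
Qed.

(** The planted law is a mixture, so the triangle inequality averages over copies; a copy
    contributes 0 if it misses [Q], and otherwise at most 1, which its number of edges in [Q]
    dominates. *)
Lemma dTV_planted_le (Q : {set {set 'I_n}}) : (0 < #|copies n g|)%N ->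
  dTV (transcript_law (planted_law q g) Q) (transcript_law (null_law q) Q) <=
  \sum_(e in Q) #|[set h in copies n g | e \in h.2]|%:R / #|copies n g|%:R.
Proof.
set C := copies n g => C_gt0; pose N : R := #|C|%:R.
have N_gt0 : 0 < N by rewrite ltr0n.
pose P (h : vegraph 'I_n) : {set {set 'I_n}} -> R := edge_law (fun e =>
  if e \in h.2 then 1 else q).
have P_ge0 h G : 0 <= P h G by apply: edge_law_ge0 => e; apply: planted_prob01.
have P0_ge0 G : 0 <= null_law q G by apply: edge_law_ge0.
have T_ge0 P' t : (forall G, 0 <= P' G) -> 0 <= transcript_law P' Q t :> R.
  by move=> ?; apply: sumr_ge0.
have diffE t : transcript_law (planted_law q g) Q t - transcript_law (null_law q) Q t
    = N^-1 * \sum_(h in C) (transcript_law (P h) Q t - transcript_law (null_law q) Q t).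
  rewrite sumrB sumr_const -[X in _ = _ * (_ - X)]mulr_natl mulrBr mulKf ?gt_eqF //.
  congr (_ - _); rewrite /transcript_law exchange_big mulr_sumr.
  by apply: eq_bigr => G _; rewrite /planted_law.
(* The factor 2 is the largest l1 distance between two probability laws; it cancels the [2^-1] of
   [dTV]. *)
have boundh h : \sum_t `|transcript_law (P h) Q t - transcript_law (null_law q) Q t|
    <= 2 * \sum_(e in Q) (e \in h.2)%:R.
  case: (boolP [exists e in Q, e \in h.2]) => [/exists_inP[e eQ eh]|].
    apply: (@le_trans _ _ 2); last first.
      rewrite ler_peMr // (bigD1 e) //= eh lerDl.
      by apply: sumr_ge0.
    apply: le_trans (_ : \sum_t (transcript_law (P h) Q t + transcript_law (null_law q) Q t) <= _).
      apply: ler_sum => t _; rewrite (le_trans (ler_normB _ _)) //.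
      by rewrite !ger0_norm ?T_ge0.
    by rewrite big_split /= !sum_transcript !sum_edge_law.
  rewrite negb_exists_in => /forall_inP disj.
  rewrite big1 ?mulr_ge0 ?sumr_ge0 // => t _.
  rewrite (@eq_transcript_edge_law _ _ _ (fun=> q)) ?subrr ?normr0 //.
  by move=> e /disj /negbTE ->.
rewrite /dTV.
have : \sum_t `|transcript_law (planted_law q g) Q t - transcript_law (null_law q) Q t|
    <= N^-1 * \sum_(h in C) (2 * \sum_(e in Q) (e \in h.2)%:R).
  apply: (le_trans _ (ler_wpM2l _ (ler_sum _ (fun h _ => boundh h))));
    last first.
    by rewrite invr_ge0 ltW.
  rewrite exchange_big mulr_sumr; apply: ler_sum => t _.
  rewrite diffE normrM gtr0_norm ?invr_gt0 //.
  by apply: ler_wpM2l; rewrite ?invr_ge0 ?ler_norm_sum // ltW.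
move=> sum_le; apply: le_trans (ler_wpM2l _ sum_le) _;
  first by rewrite invr_ge0.
rewrite -mulr_sumr mulrCA (mulrA 2^-1) mulVf ?pnatr_eq0 //
  mul1r exchange_big /=.
rewrite mulr_sumr; apply: ler_sum => e _; rewrite mulrC.
apply: ler_wpM2r; first by rewrite invr_ge0 ltW.
rewrite -sum1_card natr_sum [X in _ <= X]big_mkcond [X in X <= _]big_mkcond /=.
by apply: ler_sum => h _; rewrite [in leRHS]inE; case: (h \in C);
  case: (_ \in _).
Qed.

Lemma opt_risk_bip_bounds (A B : {set T}) (k : nat) : [disjoint A & B] ->
  (2 <= n)%N -> (#|A| + #|B| <= n)%N -> g = bip A B ->
  1 - k%:R * (#|A|%:R * #|B|%:R / 'C(n, 2)%:R) <= opt_risk n q g k <= 1.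
Proof.
move=> dAB n2 ABn gE.
(* The sides fit into [n] vertices, so a copy exists and the planted law is a genuine average. *)
have N_gt0 : (0 < #|copies n g|)%N.
  have [U _ cU] : exists2 U : {set 'I_n}, U \subset setT & #|U| = #|A|.
    by apply: exists_subset_card; rewrite cardsT card_ord; lia.
  have [V sV cV] : exists2 V : {set 'I_n}, V \subset ~: U & #|V| = #|B|.
    by apply: exists_subset_card; have := cardsC U; rewrite card_ord; lia.
  apply/card_gt0P; exists (bip U V); rewrite gE; apply: bip_copies => //;
    first lia.
  by rewrite disjoint_sym disjoints_subset.
have C2_gt0 : 0 < 'C(n, 2)%:R :> R by rewrite ltr0n bin_gt0.
rewrite /opt_risk; apply/andP; split; last first.
  by rewrite lerBlDr lerDl bigmax_ge_id.
rewrite lerD2l lerN2.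
apply: bigmax_le => [|Q /andP[sQ cQ]].
  by rewrite mulr_ge0 // divr_ge0 ?mulr_ge0 // ltW.
apply: le_trans (dTV_planted_le _ N_gt0) _.
rewrite (eq_bigr (fun=> #|A|%:R * #|B|%:R / 'C(n, 2)%:R)).
  rewrite sumr_const -[leLHS]mulr_natl; apply: ler_wpM2r;
    last by rewrite ler_nat.
  by rewrite divr_ge0 ?mulr_ge0 // ltW.
move=> e /(subsetP sQ) eP; apply/eqP.
rewrite eqr_div ?pnatr_eq0 -?lt0n ?bin_gt0 // -!natrM eqr_nat gE.
by rewrite (card_copies_edge dAB eP).
Qed.

End Planted.

(** Equivalent to [n^2 <= 2 n (n - 1)]; parity of [n (n - 1)] removes the integer halving. *)
Lemma bin2_ge (R : realType) (n : nat) : (2 <= n)%N ->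
  n%:R ^+ 2 <= 4 * 'C(n, 2)%:R :> R.
Proof.
move=> n2; rewrite -natrX -natrM ler_nat bin2 -divn2.
have := divnK (_ : 2 %| n * n.-1)%N; rewrite dvdn2 oddM.
have -> : odd n && odd n.-1 = false by case: n n2 => [|n] //= _; case: (odd n).
by move=> /(_ isT); nia.
Qed.

Lemma bip_weak_detection_impossible (R : realType) (q : R) (q01 : 0 <= q <= 1)
    (a b Q : nat -> nat) :
  (forall n, (2 <= n)%N ->
     [/\ (1 <= a n)%N, (a n <= b n)%N & (a n + b n <= n)%N]) ->
  ((fun n => (Q n)%:R : R) =o_\oo
     (fun n => n%:R ^+ 2 / ((a n)%:R * (b n)%:R) : R))%classic ->
  weak_detection_impossible q (fun n => complete_bipartite (a n) (b n)) Q.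
Proof.
move=> abn /eqoP Qo; rewrite /weak_detection_impossible.
apply/cvgrPdist_le => eps eps_gt0.
(* The 4 pays for replacing ['C(n, 2)] by [n^2] through [bin2_ge]. *)
have e4 : 0 < eps / 4 by rewrite divr_gt0.
near=> n.
have n2 : (2 <= n)%N by near: n; exact: nbhs_infty_ge.
have [a1 ab abn'] := abn n n2.
have := @opt_risk_bip_bounds R n q _ (complete_bipartite (a n) (b n)) q01 _ _ (Q n)
  (disjoint_inl_inr (a n) (b n)) n2.
rewrite !card_imset; [|by move=> ? ? []|by move=> ? ? []].
rewrite !card_ord => /(_ abn' (complete_bipartiteE _ _)) /andP[lo hi].
rewrite ger0_norm ?subr_ge0 // lerBlDr -lerBlDl (le_trans _ lo) // lerD2l lerN2.
have : `|(Q n)%:R : R| <= eps / 4 * `|n%:R ^+ 2 / ((a n)%:R * (b n)%:R) : R|.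
  by near: n; apply: Qo.
have a_gt0 : 0 < (a n)%:R :> R by rewrite ltr0n.
have b_gt0 : 0 < (b n)%:R :> R by rewrite ltr0n (leq_trans a1).
have C_gt0 : 0 < 'C(n, 2)%:R :> R by rewrite ltr0n bin_gt0.
rewrite !ger0_norm ?divr_ge0 ?sqr_ge0 ?mulr_ge0 // => Qle.
have := bin2_ge R n2; set c := 'C(n, 2)%:R in C_gt0 *.
set m := (a n)%:R * (b n)%:R in Qle *.
have m_gt0 : 0 < m by rewrite mulr_gt0.
move=> nc; rewrite mulrA ler_pdivrMr //.
apply: le_trans (ler_wpM2r (ltW m_gt0) Qle) _.
have -> : eps / 4 * (n%:R ^+ 2 / m) * m = eps / 4 * n%:R ^+ 2.
  by field; rewrite gt_eqF.
by nra.
Unshelve. all: by end_near.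
Qed.

(** * The witness scan test *)

Lemma bin_leq_expn (n k : nat) : ('C(n, k) <= n ^ k)%N.
Proof.
have ffact_leq : (n ^_ k <= n ^ k)%N.
  elim: k n => [|k IH] [|n] //; rewrite ffactSS expnS leq_pmul2l //.
  by rewrite (leq_trans (IH n)) //; case: (k) => // k'; rewrite leq_exp2r.
by rewrite (leq_trans _ ffact_leq) // -bin_ffact leq_pmulr // fact_gt0.
Qed.

(** * Union bounds and averaging over the planted copy *)

Section Bounds.
Variables (R : realType) (n : nat).
Local Notation edgeset := {set {set 'I_n}}.

(** Union bound in which the covering is required only on graphs of nonzero mass, so that almost
    sure facts may be used. *)
Lemma sum_event_union (P : edgeset -> R) (I : finType) (E : pred edgeset)
    (A : pred I) (F : I -> pred edgeset) : (forall G, 0 <= P G) ->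
  (forall G, P G != 0 -> E G -> exists2 i, A i & F i G) ->
  \sum_(G | E G) P G <= \sum_(i | A i) \sum_(G | F i G) P G.
Proof.
move=> P0 EF; under [leRHS]eq_bigr => i _ do rewrite big_mkcond.
rewrite exchange_big /= big_mkcond; apply: ler_sum => G _.
have sum0 : 0 <= \sum_(i | A i) (if F i G then P G else 0).
  by apply: sumr_ge0 => i _; case: ifP.
case: ifP => // EG; have [PG0|PG] := eqVneq (P G) 0; first by rewrite {1}PG0.
have [i Ai Fi] := EF G PG EG.
by rewrite (bigD1 i) //= Fi lerDl sumr_ge0 // => j _; case: ifP.
Qed.

Lemma le_sum_event (P : edgeset -> R) (E F : pred edgeset) :
  (forall G, 0 <= P G) -> (forall G, P G != 0 -> E G -> F G) ->
  \sum_(G | E G) P G <= \sum_(G | F G) P G.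
Proof.
move=> P0 EF; rewrite big_mkcond [leRHS]big_mkcond; apply: ler_sum => G _.
case: ifP => [EG|_]; last by case: ifP.
by case: (eqVneq (P G) 0) => [-> |/EF/(_ EG) ->//]; rewrite if_same.
Qed.

(** By averaging, an error bound uniform over fixed planted copies passes to the planted law. *)
Lemma prob_output_planted_le (q : R) (T : finType) (g : vegraph T)
    (d : procedure R n) (c : bool) (eps : R) : 0 <= eps ->
  (forall h, h \in copies n g -> prob_output d
     (edge_law (fun e => if e \in h.2 then 1 else q)) c <= eps) ->
  prob_output d (planted_law q g) c <= eps.
Proof.
move=> eps0 heps; set N := #|copies n g|.
have -> : prob_output d (planted_law q g) c = N%:R^-1 *
    \sum_(h in copies n g) prob_output d
      (edge_law (fun e => if e \in h.2 then 1 else q)) c.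
  rewrite /prob_output exchange_big mulr_sumr; apply: eq_bigr => s _.
  rewrite -mulr_sumr mulrCA; congr (_ * _).
  by rewrite exchange_big mulr_sumr.
apply: le_trans (_ : N%:R^-1 * (N%:R * eps) <= _).
  apply: ler_wpM2l; first by rewrite invr_ge0.
  by rewrite mulr_natl -sumr_const; apply: ler_sum.
(* Without copies the inverse of 0 is 0 and the claim reduces to [0 <= eps]. *)
case: (posnP N) => [->|N_gt0]; first by rewrite mul0r mulr0.
by rewrite mulKf // pnatr_eq0 -lt0n.
Qed.

Lemma prob_output_ge0 (d : procedure R n) (P : edgeset -> R) c :
  (forall s, 0 <= seed_law (p := d) s) -> (forall G, 0 <= P G) ->
  0 <= prob_output d P c.
Proof.
by move=> d0 P0; apply: sumr_ge0 => s _; rewrite mulr_ge0 // sumr_ge0.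
Qed.

Lemma planted_law_ge0 (q : R) (T : finType) (g : vegraph T) (G : edgeset) :
  0 <= q <= 1 -> 0 <= planted_law q g G.
Proof.
move=> q01; rewrite mulr_ge0 ?invr_ge0 // sumr_ge0 // => h _.
by apply: edge_law_ge0 => e; apply: planted_prob01.
Qed.

Lemma error_sum_ge0 (q : R) (T : finType) (g : vegraph T) (d : procedure R n) :
  0 <= q <= 1 -> (forall s, 0 <= seed_law (p := d) s) -> 0 <= error_sum q g d.
Proof.
move=> q01 d0; rewrite addr_ge0 // prob_output_ge0 // => G.
  by apply: edge_law_ge0.
exact: planted_law_ge0.
Qed.

End Bounds.

Lemma witness_scan_law_ge0 (R : realType) (n M : nat) (T : finType)
    (h : vegraph T) S : 0 <= seed_law (p := witness_scan R n M h) S.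
Proof. by rewrite divr_ge0. Qed.

Lemma witness_scan_within_budget (R : realType) (n M k : nat) (T : finType)
    (h : vegraph T) : (M <= n)%N -> ('C(M, 2) <= k)%N ->
  within_budget k (witness_scan R n M h).
Proof.
move=> Mn Mk; split; [exact: witness_scan_law_ge0|exact: sum_draws1|].
move=> S; rewrite /= mulf_eq0 negb_or pnatr_eq0 => /andP[+ _].
case: (eqVneq #|S| M) => // cS _; apply/andP; split.
  by apply/subsetP => e; rewrite !inE subsetT => /andP[].
by rewrite /pairs cards_draws cS.
Qed.

Section WitnessScan.
Variables (R : realType) (n M s : nat) (q x : R) (T : finType).
Variables (A B A' B' : {set T}).
Hypotheses (q_gt0 : 0 < q) (q_lt1 : q < 1) (x_gt0 : 0 < x).
Hypotheses (M_gt0 : (0 < M)%N) (M_le : (M <= n)%N) (s_gt0 : (0 < s)%N).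
Hypotheses (dAB : [disjoint A & B]) (sA : A' \subset A) (sB : B' \subset B).
Hypotheses (cA' : #|A'| = s) (cB' : #|B'| = s).
Hypotheses (s_large : 3 * ln n%:R <= s%:R * - ln q).
Hypotheses (A_large : 2 * s%:R <= #|A|%:R * M%:R / n%:R :> R).
Hypotheses (B_large : 2 * s%:R <= #|B|%:R * M%:R / n%:R :> R).
Hypotheses (A_x : x <= #|A|%:R * M%:R / n%:R) (B_x :
  x <= #|B|%:R * M%:R / n%:R).

Let dAB' : [disjoint A' & B'].
Proof. exact: (disjointWl sA (disjointWr sB dAB)). Qed.
Let n_gt0 : (0 < n)%N. Proof. exact: leq_trans M_le. Qed.
Let q01 : 0 <= q <= 1. Proof. by rewrite !ltW. Qed.

Local Notation scan := (witness_scan R n M (bip A' B')).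

(** Union bound over at most [n^(2s)] pairs of sides: [n^(2s) q^(s^2) = expR (s (2 ln n + s ln q))],
    at most [expR (- s ln n)] by [s_large], hence at most [1 / n]. *)
Lemma witness_scan_type1 : prob_output scan (null_law q) true <=
  expR (- ln n%:R).
Proof.
rewrite -[leRHS]mul1r -[X in _ <= X * _](sum_draws1 R M_le) mulr_suml.
apply: ler_sum => S _; apply: ler_wpM2l; first exact: witness_scan_law_ge0.
pose ok (UV : {set 'I_n} * {set 'I_n}) :=
  [&& [disjoint UV.1 & UV.2], #|UV.1| == s & #|UV.2| == s].
pose F (UV : {set 'I_n} * {set 'I_n}) :=
  [pred G : {set {set 'I_n}} | cross UV.1 UV.2 \subset G].
apply: le_trans (_ : \sum_(UV | ok UV) \sum_(G | F UV G) null_law q G <= _).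
  apply: sum_event_union => [G|G _]; first exact: edge_law_ge0.
  rewrite eqb_id => /exists_inP[c cC /and3P[_ _ /= c2]].
  have [U [V [dUV cU cV cE]]] := mem_copies_bip dAB' cC.
  exists (U, V); first by rewrite /ok dUV cU cV cA' cB' !eqxx.
  by move: c2; rewrite cE subsetI => /andP[].
apply: le_trans (_ : \sum_(UV | ok UV) q ^+ (s * s) <= _).
  apply: ler_sum => -[U V] /and3P[/= dUV /eqP cU /eqP cV].
  rewrite sum_edge_law_sup.
    by rewrite prodr_const card_cross // cU cV.
  apply: subset_trans (cross_pairs dUV) _.
  by apply/subsetP => e; rewrite !inE subsetT => /andP[].
have nE : n%:R = expR (ln n%:R) :> R by rewrite lnK // posrE ltr0n.
have qE : q = expR (ln q) by rewrite lnK // posrE.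
rewrite sumr_const -[leLHS]mulr_natl.
apply: le_trans (_ : (n%:R ^+ s * n%:R ^+ s) * q ^+ (s * s) <= _).
  apply: ler_wpM2r; first by rewrite exprn_ge0 // ltW.
  rewrite -!natrX -natrM ler_nat.
  apply: (@leq_trans ('C(n, s) * 'C(n, s))); last first.
    by rewrite leq_mul // bin_leq_expn.
  have <- : #|[set U : {set 'I_n} | #|U| == s]| = 'C(n, s).
    by rewrite card_draws card_ord.
  rewrite -cardsX; apply/subset_leq_card/subsetP.
  by move=> [U V] /and3P[/= _ cU cV]; rewrite !inE cU cV.
rewrite {1 2}nE qE -!expRM_natr -!expRD ler_expR natrM.
have s1 : 1 <= s%:R :> R by rewrite ler1n.
have x0 : 0 <= ln n%:R :> R by rewrite ln_ge0 // ler1n.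
have := ler_wpM2l (ler0n R s) s_large; have := ler_wpM2l x0 s1.
by lra.
Qed.

(** Each side meets the sample in fewer than [s] vertices with probability at most [4 / x];
    otherwise the planted edges inside the sample already contain the witness. *)
Lemma witness_scan_type2 : prob_output scan (planted_law q (bip A B)) false <= 8 / x.
Proof.
apply: prob_output_planted_le; first by rewrite divr_ge0 ?ltW.
move=> h hC; have [X [Y [dXY cX cY hE]]] := mem_copies_bip dAB hC.
set p := fun e => _.
have p01 e : 0 <= p e <= 1 by apply: planted_prob01.
pose bad (Z : {set 'I_n}) (S : {set 'I_n}) :=
  #|S :&: Z|%:R <= #|Z|%:R * M%:R / n%:R / 2 :> R.
pose w (S : {set 'I_n}) : R := (#|S| == M)%:R / 'C(n, M)%:R.
have w_ge0 S : 0 <= w S by rewrite divr_ge0.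
have tail (Z : {set 'I_n}) : x <= #|Z|%:R * M%:R / n%:R ->
    \sum_(S | bad Z S) w S <= 4 / x.
  move=> xZ; have Z_gt0 : (0 < #|Z|)%N.
    rewrite lt0n; apply: contraTneq xZ => ->.
    by rewrite !mul0r -ltNge.
  apply: le_trans (draws_lower_tail M_gt0 M_le Z_gt0 erefl) _.
  by rewrite ler_pM2l // lef_pV2 // posrE // (lt_le_trans x_gt0).
apply: le_trans (_ : \sum_S w S * ((bad X S)%:R + (bad Y S)%:R) <= _);
  last first.
  under eq_bigr => S _ do rewrite mulrDr.
  rewrite big_split /= (_ : 8 / x = 4 / x + 4 / x); last by ring.
  have mk Z : \sum_S w S * (bad Z S)%:R = \sum_(S | bad Z S) w S.
    rewrite [RHS]big_mkcond; apply: eq_bigr => S _.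
    by case: (bad Z S); rewrite ?mulr1 ?mulr0.
  by rewrite !mk; apply: lerD; apply: tail; rewrite ?cX ?cY.
apply: ler_sum => S _; apply: ler_wpM2l; first exact: w_ge0.
have le1 : \sum_(G | test S (G :&: query S) == false) edge_law p G <= 1.
  rewrite -[leRHS](sum_edge_law p); apply: le_sum_event => // G.
  exact: edge_law_ge0.
case: (boolP (bad X S)) => [_|]; first by rewrite (le_trans le1) // lerDl.
case: (boolP (bad Y S)) => [_ _|]; first by rewrite (le_trans le1) // lerDr.
rewrite /bad -!ltNge cX cY => SY SX; rewrite addr0.
have big Z (c : R) : 2 * s%:R <= c -> c / 2 < #|S :&: Z|%:R ->
  (s <= #|S :&: Z|)%N.
  move=> h1 h2; rewrite -(ler_nat R); lra.
have [U sU cU] := exists_subset_card (big _ _ A_large SX).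
have [V sV cV] := exists_subset_card (big _ _ B_large SY).
(* On a good sample the test rejects only graphs of mass 0, because all planted edges between [U]
   and [V] are present. *)
rewrite big1 // => G testF; apply: contraTeq testF => /edge_law_support[GP Gp].
rewrite eqbF_neg negbK; apply/exists_inP; exists (bip U V).
  apply: bip_copies; rewrite ?cU ?cV //.
  apply: (disjointWl sU); apply: (disjointWr sV).
  by apply: (disjointWl (subsetIr _ _)); apply: (disjointWr (subsetIr _ _)).
have sUS : U \subset S := subset_trans sU (subsetIl _ _).
have sVS : V \subset S := subset_trans sV (subsetIl _ _).
have dUV : [disjoint U & V].
  apply: (disjointWl (subset_trans sU (subsetIr _ _))).
  exact: (disjointWr (subset_trans sV (subsetIr _ _))).
rewrite /subgraph /is_graph cross_pairs //= subUset sUS sVS /= subsetI.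
apply/andP; split; last first.
  apply: subset_trans (cross_pairs dUV) _; apply/subsetP => e; rewrite !inE.
  move=> /andP[eUV ->]; rewrite andbT (subset_trans eUV) //.
  by rewrite subUset sUS sVS.
apply: subset_trans (crossS (subset_trans sU (subsetIr _ _))
  (subset_trans sV (subsetIr _ _))) _.
apply/subsetP => e eXY; apply: Gp; last by rewrite /p hE /= eXY.
by have := subsetP (cross_pairs dXY) e eXY; rewrite !inE subsetT => /andP[].
Qed.

End WitnessScan.

(** * The degree scan test *)

Definition star (T : finType) (v : T) (S : {set T}) : {set {set T}} :=
  [set [set v; s] | s in S :\ v].

Lemma card_star (T : finType) (v : T) (S : {set T}) : #|star v S| = #|S :\ v|.
Proof.
rewrite card_in_imset // => s s'; rewrite !inE => /andP[sv _] /andP[s'v _].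
by move/setP/(_ s); rewrite !inE eqxx orbT (negbTE sv) /= => /esym/eqP.
Qed.

Lemma star_pairs (T : finType) (v : T) (S : {set T}) :
  star v S \subset pairs [set: T].
Proof.
apply/subsetP => _ /imsetP[s + ->]; rewrite !inE subsetT cards2 eq_sym.
by move=> /andP[-> _].
Qed.

Lemma starS (T : finType) (v : T) (S S' : {set T}) :
  S \subset S' -> star v S \subset star v S'.
Proof. by move=> sS; apply: imsetS; apply: setSD. Qed.

Lemma star_sub_cross (T : finType) (v : T) (S X Y : {set T}) :
  v \in X -> S \subset Y -> star v S \subset cross X Y.
Proof.
move=> vX /subsetP SY; apply/subsetP => _ /imsetP[s + ->].
by rewrite !inE => /andP[_ /SY sY]; apply/imset2P; exists v s.
Qed.

(** Every edge of [cross X Y] has an endpoint in [Y], and these pairs have none; under planting they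
    keep probability [q]. *)
Lemma star_disjoint_cross (T : finType) (v : T) (S X Y : {set T}) e :
  v \notin Y -> e \in star v (S :\: Y) -> e \notin cross X Y.
Proof.
move=> vY /imsetP[s + ->]; rewrite !inE => /and3P[_ sY _].
apply/negP => /imset2P[x y _ yY /setP/(_ y)]; rewrite !inE eqxx orbT.
by case/orP => /eqP ey; [move: vY | move: sY]; rewrite -ey yY.
Qed.

(** The 1 accounts for [v], which may itself have been sampled in [S]. *)
Lemma leq_card_setDD1 (T : finType) (v : T) (S Y : {set T}) :
  (#|S| <= #|(S :\: Y) :\ v| + #|S :&: Y| + 1)%N.
Proof.
have := cardsD1 v (S :\: Y); have := cardsID Y S.
by case: (v \in _); lia.
Qed.

(* The two samples may overlap; star v S omits v itself from S. *)
Definition degree_scan (R : realType) (n k m : nat) (thr : R) : procedure R n :=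
  @Procedure R n ({set 'I_n} * {set 'I_n})%type
    (fun AS => ((#|AS.1| == k)%:R / 'C(n, k)%:R) *
               ((#|AS.2| == m)%:R / 'C(n, m)%:R))
    (fun AS => \bigcup_(v in AS.1) star v AS.2)
    (fun AS t => [exists v in AS.1, thr <= #|t :&: star v AS.2|%:R]).

Section DegreeScan.
Variables (R : realType) (n k m : nat) (q x : R) (T : finType) (A B : {set T}).
Hypotheses (q_gt0 : 0 < q) (q_lt1 : q < 1) (x_gt0 : 0 < x).
Hypotheses (k_gt0 : (0 < k)%N) (k_le : (k <= n)%N).
Hypotheses (m_gt0 : (0 < m)%N) (m_le : (m <= n)%N).
Hypotheses (dAB : [disjoint A & B]) (A_gt0 : (0 < #|A|)%N) (B_le :
  (#|B| <= n)%N).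

Let beta : R := #|B|%:R / n%:R.
(** Half of the guaranteed gain: a good [S] contains more than [beta m / 2] vertices of the large
    side, each raising a planted mean degree by [1 - q]. *)
Let tau : R := (1 - q) * beta * m%:R / 4.

(** A sample of all vertices surely meets the small side; otherwise the expected intersection is at
    least [x]. *)
Hypothesis (k_large : (k == n) || (x <= #|A|%:R * k%:R / n%:R)).
Hypothesis (B_x : x <= beta * m%:R).
Hypothesis (m_large : 2 * ln n%:R <= (1 - q) ^+ 2 * beta ^+ 2 * m%:R / 128).

Let n_gt0 : (0 < n)%N. Proof. exact: leq_trans k_le. Qed.
Let q01 : 0 <= q <= 1. Proof. by rewrite !ltW. Qed.

Local Notation scan := (degree_scan n k m (q * m%:R + tau)).

Lemma degree_scan_law_ge0 (S : seed scan) : 0 <= seed_law (p := scan) S.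
Proof. by rewrite mulr_ge0 ?divr_ge0. Qed.

(** Independence of the two samples. *)
Lemma degree_scan_sum_law (f g : {set 'I_n} -> R) :
  \sum_(s : seed scan) ((#|s.1| == k)%:R / 'C(n, k)%:R * f s.1) *
    ((#|s.2| == m)%:R / 'C(n, m)%:R * g s.2) =
  (\sum_(S : {set 'I_n}) (#|S| == k)%:R / 'C(n, k)%:R * f S) *
  (\sum_(S : {set 'I_n}) (#|S| == m)%:R / 'C(n, m)%:R * g S).
Proof.
rewrite mulr_suml; under [RHS]eq_bigr => S _ do rewrite mulr_sumr.
by rewrite pair_big.
Qed.

Lemma degree_scan_sum_law1 : \sum_s seed_law (p := scan) s = 1.
Proof.
have := degree_scan_sum_law (fun=> 1) (fun=> 1).
under eq_bigr => s _ do rewrite !mulr1.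
move=> ->; under eq_bigr => s _ do rewrite mulr1.
by under [X in _ * X]eq_bigr => s _ do rewrite mulr1;
  rewrite !sum_draws1 ?mulr1.
Qed.

Lemma degree_scan_within_budget (K : nat) : (k * m <= K)%N ->
  within_budget K scan.
Proof.
move=> kmK; split; [exact: degree_scan_law_ge0|exact: degree_scan_sum_law1|].
move=> [U S]; rewrite /= !mulf_eq0 !negb_or !pnatr_eq0.
case: (eqVneq #|U| k) => [cU|_] //=; case: (eqVneq #|S| m) => [cS|_] /=;
  rewrite ?andbF // => _.
apply/andP; split; first by apply/bigcupsP => v _; apply: star_pairs.
apply: leq_trans kmK; rewrite -cU -sum_nat_const.
apply: (@leq_trans (\sum_(v in U) #|star v S|)).
  elim/big_rec2: _ => [|v V' N _ IH]; first by rewrite cards0.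
  by apply: leq_trans (leq_card_setU _ _) _; rewrite leq_add2l.
by apply: leq_sum => v _; rewrite card_star -cS subset_leq_card // subsetDl.
Qed.

Let m_gt0R : 0 < m%:R :> R. Proof. by rewrite ltr0n. Qed.

Let beta01 : 0 < beta <= 1.
Proof.
apply/andP; split; last by rewrite ler_pdivrMr ?ltr0n // mul1r ler_nat.
by have := lt_le_trans x_gt0 B_x; rewrite pmulr_lgt0.
Qed.

(* The Chernoff parameter tau / (4 m), see tauE. *)
Let slope : R := (1 - q) * beta / 16.

Let tauE : tau = 4 * slope * m%:R. Proof. by rewrite /tau /slope; field. Qed.

Let slope_gt0 : 0 < slope.
Proof. by case/andP: beta01 => b0 _; rewrite divr_gt0 // mulr_gt0 //
  subr_gt0. Qed.

Let slope_le : slope <= 16^-1.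
Proof.
case/andP: beta01 => b0 b1.
rewrite ler_pdivrMr // mulVf ?pnatr_eq0 //.
by have := mulr_ge0 (ltW q_gt0) (ltW b0); lra.
Qed.

(** The 128 of [m_large] is [16^2 / 2], so the right-hand sides agree. *)
Let slope_large : 2 * ln n%:R <= 2 * slope ^+ 2 * m%:R.
Proof.
apply: le_trans m_large _; rewrite le_eqVlt; apply/orP; left; apply/eqP.
by rewrite /slope; field.
Qed.

Let test_scanE (s : seed scan) (G : {set {set 'I_n}}) :
  test s (G :&: query s) =
  [exists v in s.1, q * m%:R + tau <= #|G :&: star v s.2|%:R].
Proof.
apply: eq_existsb => v; case: (boolP (v \in s.1)) => //= vs.
by rewrite -setIA (setIidPr (bigcup_sup v vs)).
Qed.

(** For one vertex the Chernoff exponent is at most [2 slope^2 m - slope tau = - 2 slope^2 m <= - 2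
    ln n]; the union over at most [n] vertices leaves [1 / n]. *)
Lemma degree_scan_type1 : prob_output scan (null_law q) true <=
  expR (- ln n%:R).
Proof.
rewrite -[leRHS]mul1r -[X in _ <= X * _]degree_scan_sum_law1 mulr_suml.
apply: ler_sum => -[U S] _.
have [/= w0|wn0] := eqVneq (seed_law (p := scan) (U, S)) 0;
  first by rewrite w0 !mul0r.
apply: ler_wpM2l; first exact: degree_scan_law_ge0.
have cS : #|S| = m.
  by apply: contraNeq wn0 => /= /negbTE ->; rewrite mul0r mulr0.
under eq_bigl => G do rewrite eqb_id test_scanE /=.
pose F (v : 'I_n) := [pred G : {set {set 'I_n}} |
  slope * tau <= slope * (#|G :&: star v S|%:R - q * #|star v S|%:R)].
have star_le v : #|star v S|%:R <= m%:R :> R.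
  by rewrite ler_nat card_star -cS subset_leq_card // subsetDl.
apply: le_trans (_ : \sum_(v in U) \sum_(G | F v G) null_law q G <= _).
  apply: sum_event_union => [G|G _]; first exact: edge_law_ge0.
  move=> /exists_inP[v vU deg]; exists v => //=.
  (* The star may have fewer than [m] pairs, which only lowers the centring [q * #|star v S|]. *)
  rewrite ler_pM2l // lerBrDr (le_trans _ deg) // addrC lerD2r.
  by rewrite ler_wpM2l // ltW.
apply: le_trans (_ : \sum_(v in U) expR (- (2 * ln n%:R)) <= _).
  apply: ler_sum => v _; apply: le_trans (edge_law_tail _ _ _ q01 (star_pairs _ _) _) _ => //.
    by rewrite gtr0_norm // (le_trans slope_le) // lef_pV2 ?posrE // ler_nat.
  rewrite ler_expR tauE; have := ler_wpM2l (sqr_ge0 slope) (star_le v).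
  by have := slope_large; nra.
rewrite sumr_const -[leLHS]mulr_natl.
have nE : n%:R = expR (ln n%:R) :> R by rewrite lnK // posrE ltr0n.
apply: le_trans (_ : n%:R * expR (- (2 * ln n%:R)) <= _).
  by apply: ler_wpM2r; rewrite ?expR_ge0 // ler_nat -[leqRHS]card_ord max_card.
by rewrite {1}nE -expRD ler_expR; lra.
Qed.

(** All pairs from [v] to [S :&: Y] are present, and the remaining pairs of its star are independent
    of probability [q]; a low degree therefore forces a lower deviation among the latter. *)
Lemma degree_scan_star_type2 (X Y S : {set 'I_n}) (v : 'I_n) :
  [disjoint X & Y] -> v \in X -> #|S| = m -> beta * m%:R / 2 < #|S :&: Y|%:R ->
  \sum_(G : {set {set 'I_n}} | ~~ (q * m%:R + tau <= #|G :&: star v S|%:R))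
    edge_law (fun e => if e \in cross X Y then 1 else q) G <=
  expR (1 - 2 * ln n%:R).
Proof.
move=> dXY vX cS SY; set p := fun e : {set 'I_n} => if _ then _ else _.
have vY : v \notin Y by rewrite (disjointFr dXY).
have p01 e : 0 <= p e <= 1 by rewrite /p; case: ifP; rewrite ?ler01 ?lexx.
set L : R := #|S :&: Y|%:R in SY *.
pose D := star v (S :\: Y).
have cD : m%:R - L - 1 <= #|D|%:R.
  suff : (m <= #|D| + #|S :&: Y| + 1)%N.
    by rewrite -(ler_nat R) !natrD -/L; lra.
  by rewrite -cS card_star leq_card_setDD1.
have D_le : #|D|%:R <= m%:R :> R.
  rewrite ler_nat card_star -cS subset_leq_card //.
  by rewrite (subset_trans (subsetDl _ _)) // subsetDl.
(* The deviation is at least [(1 - q) L - tau - q], and [(1 - q) L > 2 tau]; the loss of [q] comes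
   from [v] possibly lying in [S]. As [slope * q <= 1], it costs at most the 1 in the final
   exponent. *)
pose u := slope * (tau - q).
apply: le_trans (_ : \sum_(G : {set {set 'I_n}} |
    u <= - slope * (#|G :&: D|%:R - q * #|D|%:R)) edge_law p G <= _).
  apply: le_sum_event => [G|G]; first exact: edge_law_ge0.
  move=> /edge_law_support[_ Gp]; rewrite -ltNge => deg.
  rewrite mulNr -mulrN ler_pM2l //.
  have : L + #|G :&: D|%:R <= #|G :&: star v S|%:R :> R.
    have -> : L = #|star v (S :&: Y)|%:R.
      rewrite card_star; congr (_%:R); apply: eq_card => z; rewrite !inE.
      by case: eqP => // ->; rewrite (negbTE vY) andbF.
    rewrite -natrD ler_nat -(cardsUI (star v (S :&: Y))).
    have -> : star v (S :&: Y) :&: (G :&: D) = set0.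
      apply/eqP; rewrite -subset0; apply/subsetP => e; rewrite !inE.
      move=> /and3P[eY _ eD]; have := star_disjoint_cross X vY eD.
      by rewrite (subsetP (star_sub_cross vX (subsetIr S Y)) e eY).
    rewrite cards0 addn0 subset_leq_card // subUset subsetI.
    rewrite starS ?subsetIl // setIS ?starS ?subsetDl // !andbT.
    apply/subsetP => e eY; apply: Gp; first exact: subsetP (star_pairs _ _) e eY.
    by rewrite /p (subsetP (star_sub_cross vX (subsetIr S Y)) e eY).
  have : (1 - q) * (beta * m%:R / 2) <= (1 - q) * L.
    by rewrite ler_wpM2l ?subr_ge0 ?ltW.
  have : q * (m%:R - L - 1) <= q * #|D|%:R by rewrite ler_wpM2l // ltW.
  move: deg; rewrite /tau; lra.
apply: le_trans (edge_law_tail _ _ _ q01 (star_pairs _ _) _) _ => //.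
- by move=> e eD; rewrite /p ifN // (star_disjoint_cross X vY eD).
- by rewrite normrN gtr0_norm // (le_trans slope_le) // lef_pV2 ?posrE //
  ler_nat.
rewrite ler_expR /u tauE sqrrN.
have := ler_wpM2l (sqr_ge0 slope) D_le; have := slope_large.
have : slope * q <= 1.
  by have := ler_wpM2l (ltW slope_gt0) (ltW q_lt1); have := slope_le; lra.
nra.
Qed.

(** Failure needs the first sample to miss [X], or the second to contain too little of [Y], or a
    planted vertex to have a low degree. *)
Lemma degree_scan_type2 : prob_output scan (planted_law q (bip A B)) false <=
  8 / x + expR (1 - 2 * ln n%:R).
Proof.
have bound0 : 0 <= 8 / x + expR (1 - 2 * ln n%:R).
  by rewrite addr_ge0 ?expR_ge0 // divr_ge0 // ltW.
apply: prob_output_planted_le => // h hC.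
have [X [Y [dXY cX cY hE]]] := mem_copies_bip dAB hC.
set p := fun e => _.
have p01 e : 0 <= p e <= 1 by apply: planted_prob01.
pose bad1 (U : {set 'I_n}) := U :&: X == set0.
pose bad2 (S : {set 'I_n}) := #|S :&: Y|%:R <= beta * m%:R / 2.
pose w1 (S : {set 'I_n}) : R := (#|S| == k)%:R / 'C(n, k)%:R.
pose w2 (S : {set 'I_n}) : R := (#|S| == m)%:R / 'C(n, m)%:R.
have w1_ge0 S : 0 <= w1 S by rewrite divr_ge0.
have w2_ge0 S : 0 <= w2 S by rewrite divr_ge0.
have prob1 : \sum_U w1 U * (bad1 U)%:R <= 4 / x.
  case/orP: k_large => [/eqP kn|kx].
    rewrite big1 ?divr_ge0 ?ltW // => U _; rewrite /w1 /bad1.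
    case: (eqVneq #|U| k) => [cU|_]; last by rewrite !mul0r.
    have -> : U = setT by apply/eqP; rewrite eqEcard subsetT cardsT card_ord cU kn leqnn.
    by rewrite setTI -cards_eq0 cX gtn_eqF // mulr0.
  have kn0 : 0 < #|X|%:R * k%:R / n%:R :> R by rewrite cX (lt_le_trans x_gt0).
  have X_gt0 : (0 < #|X|)%N by rewrite cX.
  apply: le_trans (_ : 4 / (#|X|%:R * k%:R / n%:R) <= _); last first.
    by rewrite ler_pM2l // lef_pV2 ?posrE // cX.
  (* Missing [X] is an instance of falling below half of the mean. *)
  apply: le_trans (draws_lower_tail k_gt0 k_le X_gt0 erefl).
  rewrite [leRHS]big_mkcond; apply: ler_sum => U _; rewrite -/(w1 U) /bad1.
  case: eqP => [->|_]; last by rewrite mulr0; case: ifP.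
  by rewrite mulr1 cards0 ifT // divr_ge0 // ltW.
have Y_gt0 : (0 < #|Y|)%N.
  rewrite lt0n cY; apply: contraTneq (lt_le_trans x_gt0 B_x) => B0.
  by rewrite /beta B0 !mul0r ltxx.
have prob2 : \sum_S w2 S * (bad2 S)%:R <= 4 / x.
  have muE : beta * m%:R = #|Y|%:R * m%:R / n%:R by rewrite cY /beta mulrAC.
  apply: le_trans (_ : 4 / (beta * m%:R) <= _); last first.
    by rewrite ler_pM2l // lef_pV2 ?posrE // (lt_le_trans x_gt0).
  apply: le_trans (draws_lower_tail m_gt0 m_le Y_gt0 muE).
  rewrite [leRHS]big_mkcond; apply: ler_sum => S _; rewrite -/(w2 S) /bad2.
  by case: ifP; rewrite ?mulr1 ?mulr0.
set c := expR (1 - 2 * ln n%:R) in bound0 *.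
have c_ge0 : 0 <= c by rewrite expR_ge0.
apply: le_trans (_ : \sum_(s : seed scan) w1 s.1 * w2 s.2 *
    ((bad1 s.1)%:R + (bad2 s.2)%:R + c) <= _); last first.
  have sum1 : \sum_U w1 U * 1 = 1.
    by under eq_bigr => U _ do rewrite mulr1; rewrite sum_draws1.
  have sum2 : \sum_U w2 U * 1 = 1.
    by under eq_bigr => U _ do rewrite mulr1; rewrite sum_draws1.
  under eq_bigr => s _ do rewrite !mulrDr.
  rewrite !big_split /=.
  have e1 := degree_scan_sum_law (fun U => (bad1 U)%:R) (fun=> 1).
  have e2 := degree_scan_sum_law (fun=> 1) (fun S => (bad2 S)%:R).
  have e3 := degree_scan_sum_law (fun=> 1) (fun=> c).
  rewrite (_ : \sum_i _ = \sum_U w1 U * (bad1 U)%:R); last first.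
    rewrite -[RHS]mulr1 -[X in _ = _ * X]sum2 -e1.
    by apply: eq_bigr => s _; rewrite mulr1 mulrAC.
  rewrite (_ : \sum_i w1 i.1 * w2 i.2 * (bad2 i.2)%:R =
    \sum_U w2 U * (bad2 U)%:R); last first.
    rewrite -[RHS]mul1r -[X in _ = X * _]sum1 -e2.
    by apply: eq_bigr => s _; rewrite mulr1 mulrA.
  rewrite -mulr_suml [X in _ + X * c]degree_scan_sum_law1 mul1r.
  by rewrite lerD2r (_ : 8 / x = 4 / x + 4 / x); [apply: lerD|ring].
apply: ler_sum => -[U S] _.
have [/= w0|wn0] := eqVneq (seed_law (p := scan) (U, S)) 0;
  first by rewrite /= (w0 : w1 U * w2 S = 0) !mul0r.
apply: ler_wpM2l; first exact: degree_scan_law_ge0.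
have cS : #|S| = m.
  by apply: contraNeq wn0 => /= /negbTE ->; rewrite mul0r mulr0.
under eq_bigl => G do rewrite eqbF_neg test_scanE /=.
have le1 (E : pred {set {set 'I_n}}) : \sum_(G | E G) edge_law p G <= 1.
  by rewrite -[leRHS](sum_edge_law p); apply: le_sum_event => // G;
    exact: edge_law_ge0.
case: (boolP (bad1 U)) => [_|/set0Pn[v /setIP[vU vX]]].
  by rewrite (le_trans (le1 _)) // -addrA lerDl addr_ge0.
case: (boolP (bad2 S)) => [_|].
  by rewrite (le_trans (le1 _)) // add0r lerDl.
rewrite -ltNge !add0r => SY.
apply: le_trans (degree_scan_star_type2 dXY vX cS SY).
rewrite (_ : p = fun e => if e \in cross X Y then 1 else q);
  last by rewrite /p hE.
apply: le_sum_event => [G|G _]; first by apply: edge_law_ge0 => e;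
  move: (p01 e); rewrite /p hE.
by rewrite negb_exists_in => /forall_inP/(_ v vU).
Qed.

End DegreeScan.

(** * Choice of parameters *)

(** Above 1, rounding up costs at most a factor 2. *)
Lemma absz_ceil_bounds (R : realType) (y : R) : 1 <= y ->
  (0 < `|Num.ceil y|)%N /\ y <= `|Num.ceil y|%:R <= 2 * y.
Proof.
move=> y1; have c_gt0 : 0 < Num.ceil y by rewrite ceil_gt0; lra.
split; first by rewrite absz_gt0 gt_eqF.
rewrite natr_absz gtr0_norm // ceil_ge /=.
by have := ceilB1_lt y; rewrite rmorphB /=; lra.
Qed.

Lemma near_ln_ge (R : realType) (A : R) : \forall n \near \oo%classic, A <=
  ln n%:R.
Proof.
near=> n; have nA : expR A <= n%:R by near: n; apply: nbhs_infty_ger.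
by rewrite -(expRK A) ler_ln ?posrE ?expR_gt0 // (lt_le_trans _ nA) ?expR_gt0.
Unshelve. all: by end_near.
Qed.

(** Brings all errors, with [x = ln n], to the common rate [1 / ln n] set by Chebyshev. *)
Lemma error_terms_le (R : realType) (x : R) : 1 <= x ->
  expR (- x) + (8 / x + expR (1 - 2 * x)) <= (9 + expR 1) / x.
Proof.
move=> x1; have x_gt0 : 0 < x by lra.
have ex : expR (- x) <= x^-1.
  rewrite expRN lef_pV2 ?posrE ?expR_gt0 //.
  by have := expR_ge1Dx x; lra.
have : expR (1 - 2 * x) <= expR 1 * x^-1.
  apply: le_trans (ler_wpM2l (expR_ge0 1) ex).
  by rewrite -expRD ler_expR; lra.
by rewrite mulrDl; lra.
Qed.

Lemma strongly_detects_of_bound (R : realType) (q c : R) (T : nat -> finType)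
    (g : forall n, vegraph (T n)) (Q : nat -> nat) (d :
      forall n, procedure R n) :
  0 <= q <= 1 -> (forall n, within_budget (Q n) (d n)) ->
  (\forall n \near \oo%classic, error_sum q (g n) (d n) <= c / ln n%:R) ->
  strongly_detects q g Q d.
Proof.
move=> q01 budget err; split => //.
apply/cvgr0Pnorm_le => eps eps_gt0; near=> n.
rewrite ger0_norm; last by apply: error_sum_ge0 => //; case: (budget n).
have x1 : 1 <= ln n%:R :> R by near: n; apply: near_ln_ge.
have xc : c / eps <= ln n%:R :> R by near: n; apply: near_ln_ge.
apply: (@le_trans _ _ (c / ln n%:R)); first by near: n.
rewrite ler_pdivrMr; last by lra.
by move: xc; rewrite ler_pdivrMr // mulrC.
Unshelve. all: by end_near.
Qed.

(** * Sample sizes for the degree scan *)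

Section DegreeScanDetects.
Variables (R : realType) (q : R).
Hypotheses (q_gt0 : 0 < q) (q_lt1 : q < 1).

(** With 256, [m_large] is an equality before [m] is rounded up. *)
Let C1 : R := 256 / (1 - q) ^+ 2.

Lemma degree_scan_detects (n a b K : nat) :
  (1 <= a)%N -> (a <= b)%N -> (a + b <= n)%N -> 1 <= ln n%:R :> R ->
  (Num.ceil (C1 * (n%:R ^+ 2 / b%:R ^+ 2) * ln n%:R))%:~R <= n%:R / 2 :> R ->
  4 * C1 * (n%:R ^+ 3 / (a%:R * b%:R ^+ 2)) * ln n%:R ^+ 2 <= K%:R ->
  exists2 d : procedure R n, within_budget K d &
    error_sum q (complete_bipartite a b) d <= (9 + expR 1) / ln n%:R.
Proof.
move=> a1 ab abn; set x := ln n%:R => x1 m_le K_ge.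
have [n_gt0 b_gt0 bn] : [/\ (0 < n)%N, (0 < b)%N & (b <= n)%N] by split; lia.
have nR : 0 < n%:R :> R by rewrite ltr0n.
have aR : 0 < a%:R :> R by rewrite ltr0n.
have bR : 0 < b%:R :> R by rewrite ltr0n.
have q1 : 0 < 1 - q by rewrite subr_gt0.
have C1_ge : 1 <= C1.
  rewrite ler_pdivlMr ?exprn_gt0 // mul1r.
  have q_le : 1 - q <= 1 by rewrite lerBlDr lerDl ltW.
  have : (1 - q) ^+ 2 <= 1 by exact: exprn_ile1 (ltW q1) q_le.
  by lra.
pose y1 := n%:R / a%:R * x; pose y2 := C1 * (n%:R ^+ 2 / b%:R ^+ 2) * x.
have na1 : 1 <= n%:R / a%:R :> R.
  by rewrite ler_pdivlMr // mul1r ler_nat (leq_trans (leq_addr b a)).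
have nb1 : 1 <= n%:R / b%:R :> R by rewrite ler_pdivlMr // mul1r ler_nat.
have [k0_gt0 /andP[k0_ge k0_le]] : (0 < `|Num.ceil y1|)%N /\
  y1 <= `|Num.ceil y1|%:R <= 2 * y1.
  by apply: absz_ceil_bounds; rewrite mulr_ege1.
have y2_ge1 : 1 <= y2.
  by rewrite /y2 -expr_div_n mulr_ege1 // mulr_ege1 // exprn_ege1.
have [m_gt0 /andP[m_ge m_le2]] := absz_ceil_bounds y2_ge1.
set k0 := `|Num.ceil y1|%N in k0_gt0 k0_ge k0_le.
set m := `|Num.ceil y2|%N in m_gt0 m_ge m_le2.
(* When [a < ln n] the desired size exceeds [n]; all vertices are then taken. *)
pose k := minn n k0.
have mn : (m <= n)%N.
  rewrite -(ler_nat R) /m natr_absz gtr0_norm; last by rewrite ceil_gt0; lra.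
  by rewrite (le_trans m_le) //; lra.
have k_gt0 : (0 < k)%N by rewrite leq_min n_gt0.
have k_n : (k <= n)%N by rewrite geq_minl.
have kmK : (k * m <= K)%N.
  rewrite -(ler_nat R) natrM; apply: le_trans K_ge.
  (* The two roundings produce the factor 4 of the budget. *)
  apply: (@le_trans _ _ ((2 * y1) * (2 * y2))).
    apply: ler_pM => //; apply: le_trans k0_le.
    by rewrite ler_nat geq_minr.
  rewrite le_eqVlt; apply/orP; left; apply/eqP; rewrite /y1 /y2.
  by field; rewrite !gt_eqF.
pose A : {set 'I_a + 'I_b} := [set inl i | i : 'I_a].
pose B : {set 'I_a + 'I_b} := [set inr j | j : 'I_b].
have cA : #|A| = a by rewrite card_imset ?card_ord // => ? ? [].
have cB : #|B| = b by rewrite card_imset ?card_ord // => ? ? [].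
have x_gt0 : 0 < x by lra.
have dAB : [disjoint A & B] := disjoint_inl_inr a b.
have A_gt0 : (0 < #|A|)%N by rewrite cA.
have B_le : (#|B| <= n)%N by rewrite cB.
have k_large : (k == n) || (x <= #|A|%:R * k%:R / n%:R).
  rewrite cA /k; case: (leqP n k0) => nk; first by rewrite eqxx.
  apply/orP; right; rewrite ler_pdivlMr //.
  have -> : x * n%:R = a%:R * y1 by rewrite /y1; field; rewrite gt_eqF.
  by rewrite ler_pM2l.
have beta_gt0 : 0 < b%:R / n%:R :> R by rewrite divr_gt0.
have B_x : x <= #|B|%:R / n%:R * m%:R.
  rewrite cB; apply: le_trans (ler_wpM2l (ltW beta_gt0) m_ge).
  have -> : b%:R / n%:R * y2 = (C1 * (n%:R / b%:R)) * x.
    by rewrite /y2; field; rewrite !gt_eqF.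
  by rewrite ler_peMl ?(ltW x_gt0) // mulr_ege1.
have m_large : 2 * ln n%:R <= (1 - q) ^+ 2 * (#|B|%:R / n%:R) ^+ 2 * m%:R / 128.
  have -> : 2 * ln n%:R = (1 - q) ^+ 2 * (#|B|%:R / n%:R) ^+ 2 * y2 / 128.
    by rewrite cB /y2 /C1 -/x; field; rewrite !gt_eqF.
  by rewrite ler_wpM2r ?invr_ge0 // ler_wpM2l // mulr_ge0 ?sqr_ge0.
exists (degree_scan n k m
  (q * m%:R + (1 - q) * (#|B|%:R / n%:R) * m%:R / 4)).
  exact: degree_scan_within_budget.
rewrite complete_bipartiteE -/A -/B; apply: le_trans (error_terms_le x1).
apply: lerD; first exact: degree_scan_type1 B_x m_large.
exact: degree_scan_type2 k_large B_x m_large.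
Qed.

(** Fallback for the small [n], since the budget must be respected at every [n]. *)
Lemma trivial_procedure (n K : nat) : exists d :
  procedure R n, within_budget K d.
Proof.
exists (@Procedure R n unit (fun=> 1) (fun=> set0) (fun _ _ => true)).
split=> [_||_ _] /=; first exact: ler01.
  by rewrite sumr_const card_unit.
by rewrite sub0set cards0.
Qed.

Lemma degree_scan_strong_detection (a b Q : nat -> nat) :
  (forall n, (2 <= n)%N ->
     [/\ (1 <= a n)%N, (a n <= b n)%N & (a n + b n <= n)%N]) ->
  (\forall n \near \oo%classic,
     (Num.ceil (C1 * (n%:R ^+ 2 / (b n)%:R ^+ 2) * ln n%:R))%:~R <=
       n%:R / 2 :> R) ->
  (\forall n \near \oo%classic,
     4 * C1 * (n%:R ^+ 3 / ((a n)%:R * (b n)%:R ^+ 2)) * ln n%:R ^+ 2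
       <= (Q n)%:R) ->
  strong_detection_possible q (fun n => complete_bipartite (a n) (b n)) Q.
Proof.
move=> abn m_le Q_ge.
pose ok n (d : procedure R n) :=
  error_sum q (complete_bipartite (a n) (b n)) d <= (9 + expR 1) / ln n%:R.
(* At each [n] choose an accurate procedure if there is one, and any admissible procedure
   otherwise. *)
have ex n : exists d : procedure R n, within_budget (Q n) d /\
    ((exists2 d', within_budget (Q n) d' & ok n d') -> ok n d).
  case: (pselect (exists2 d', within_budget (Q n) d' & ok n d')).
    by move=> [d' ? ?]; exists d'.
  by move=> no; have [d] := trivial_procedure n (Q n); exists d.
exists (fun n => projT1 (cid (ex n))).
apply: (@strongly_detects_of_bound _ _ (9 + expR 1)).
- by rewrite !ltW.
- by move=> n; have [] := projT2 (cid (ex n)).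
near=> n; have [_] := projT2 (cid (ex n)); apply.
have n2 : (2 <= n)%N by near: n; exact: nbhs_infty_ge.
have [a1 ab abn'] := abn n n2.
have [|||d' bd' ed'] := degree_scan_detects (K := Q n) a1 ab abn'.
- by near: n; apply: near_ln_ge.
- by near: n.
- by near: n.
by exists d'.
Unshelve. all: by end_near.
Qed.

End DegreeScanDetects.

(** * Sample size and witness for the witness scan *)

Section WitnessScanDetects.
Variables (R : realType) (q rho : R).
Hypotheses (q_gt0 : 0 < q) (q_lt1 : q < 1).

(** The maximum keeps the budget constant positive for every real [rho]. *)
Let rho1 : R := Num.max rho 1.
(** Chosen so that [2 s <= kappa ln n] for [s] the rounding up of [3 ln n / - ln q], the added 1
    absorbing the rounding. *)
Let kappa : R := 2 * (3 / - ln q + 1).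

Lemma witness_scan_detects (n a b K : nat) :
  (1 <= a)%N -> (a <= b)%N -> (a + b <= n)%N -> 1 <= ln n%:R :> R ->
  b%:R <= rho * a%:R -> kappa * ln n%:R <= a%:R ->
  4 * kappa ^+ 2 * rho1 * (n%:R ^+ 2 / (a%:R * b%:R)) * ln n%:R ^+ 4 <= K%:R ->
  exists M (h : vegraph ('I_a + 'I_b)%type),
    [/\ (M <= n)%N, ('C(M, 2) <= K)%N, subgraph h (complete_bipartite a b) &
      error_sum q (complete_bipartite a b) (witness_scan R n M h) <=
      (9 + expR 1) / ln n%:R].
Proof.
move=> a1 ab abn; set x := ln n%:R => x1 b_le a_ge K_ge.
have n_gt0 : (0 < n)%N by lia.
have b_gt0 : (0 < b)%N by lia.
have nR : 0 < n%:R :> R by rewrite ltr0n.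
have aR : 0 < a%:R :> R by rewrite ltr0n.
have bR : 0 < b%:R :> R by rewrite ltr0n.
have x_gt0 : 0 < x by lra.
have lam : 0 < - ln q by rewrite oppr_gt0 ln_lt0 // q_gt0 q_lt1.
have kappa_ge : 2 <= kappa.
  have : 0 < 3 / - ln q by rewrite divr_gt0.
  by rewrite /kappa; lra.
pose y := kappa * (n%:R / a%:R) * x.
have na1 : 1 <= n%:R / a%:R :> R.
  by rewrite ler_pdivlMr // mul1r ler_nat (leq_trans (leq_addr b a)).
have y1 : 1 <= y.
  by rewrite mulr_ege1 // mulr_ege1 //; lra.
have [M0_gt0 /andP[M0_ge M0_le]] := absz_ceil_bounds y1.
set M0 := `|Num.ceil y|%N in M0_gt0 M0_ge M0_le.
pose M := minn n M0.
have M_gt0 : (0 < M)%N by rewrite leq_min n_gt0.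
have M_n : (M <= n)%N by rewrite geq_minl.
have t_gt0 : 0 < 3 * x / - ln q by rewrite divr_gt0 // mulr_gt0.
pose s := `|Num.ceil (3 * x / - ln q)|%N.
have c_gt0 : 0 < Num.ceil (3 * x / - ln q) by rewrite ceil_gt0.
have s_gt0 : (0 < s)%N by rewrite absz_gt0 gt_eqF.
have sE : s%:R = (Num.ceil (3 * x / - ln q))%:~R :> R.
  by rewrite natr_absz gtr0_norm.
have s_ge : 3 * x <= s%:R * - ln q.
  by rewrite -ler_pdivrMr // sE ceil_ge.
have s_le : 2 * s%:R <= kappa * x.
  have := ceilB1_lt (3 * x / - ln q); rewrite rmorphB /= -sE.
  have -> : kappa * x = 2 * (3 * x / - ln q + x).
    by rewrite /kappa; ring.
  by lra.
(* If the sample is everything, this is the lower bound on [a]; otherwise it is the choice of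
   [y]. *)
have a_large : kappa * x <= a%:R * M%:R / n%:R.
  rewrite ler_pdivlMr // /M; case: (leqP n M0) => _.
    by rewrite ler_pM2r.
  have -> : kappa * x * n%:R = a%:R * y by rewrite /y; field; rewrite gt_eqF.
  by rewrite ler_pM2l.
have b_large : kappa * x <= b%:R * M%:R / n%:R.
  apply: le_trans a_large _; rewrite ler_pM2r ?invr_gt0 // ler_pM2r ?ltr0n //.
  by rewrite ler_nat.
have kx : x <= kappa * x by rewrite ler_peMl ?(ltW x_gt0) //; lra.
have sa : (s <= a)%N.
  by rewrite -(ler_nat R); have := ler0n R s; lra.
pose A : {set 'I_a + 'I_b} := [set inl i | i : 'I_a].
pose B : {set 'I_a + 'I_b} := [set inr j | j : 'I_b].
have cA : #|A| = a by rewrite card_imset ?card_ord // => ? ? [].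
have cB : #|B| = b by rewrite card_imset ?card_ord // => ? ? [].
have [A' sA cA'] : exists2 A' : {set 'I_a + 'I_b}, A' \subset A & #|A'| = s.
  by apply: exists_subset_card; rewrite cA.
have [B' sB cB'] : exists2 B' : {set 'I_a + 'I_b}, B' \subset B & #|B'| = s.
  by apply: exists_subset_card; rewrite cB (leq_trans sa).
have dAB : [disjoint A & B] := disjoint_inl_inr a b.
exists M, (bip A' B'); split => //.
- rewrite (@leq_trans (M * M)) //.
    by rewrite bin2 -divn2 (leq_trans (leq_div _ _)) // leq_mul // leq_pred.
  rewrite -(ler_nat R) natrM; apply: le_trans K_ge.
  apply: (@le_trans _ _ ((2 * y) * (2 * y))).
    have M_le : M%:R <= 2 * y by apply: le_trans M0_le;
      rewrite ler_nat geq_minr.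
    by apply: ler_pM.
  have -> : 2 * y * (2 * y) = 4 * kappa ^+ 2 * (n%:R ^+ 2 / (a%:R * b%:R)) *
      (b%:R / a%:R) * x ^+ 2.
    by rewrite /y; field; rewrite !gt_eqF.
  (* Balance of the sides turns the cost of order [n^2 / a^2] into [n^2 / (a b)]. *)
  have ba : b%:R / a%:R <= rho1.
    rewrite ler_pdivrMr // (le_trans b_le) //.
    by apply: ler_wpM2r; rewrite ?le_max ?lexx // ltW.
  have x24 : x ^+ 2 <= x ^+ 4 by rewrite ler_weXn2l.
  have c0 : 0 <= 4 * kappa ^+ 2 * (n%:R ^+ 2 / (a%:R * b%:R)).
    apply: mulr_ge0; first by rewrite pmulr_rge0 // sqr_ge0.
    by rewrite divr_ge0 ?sqr_ge0 // mulr_ge0 ?ltW.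
  rewrite [leRHS](_ : _ = 4 * kappa ^+ 2 * (n%:R ^+ 2 / (a%:R * b%:R)) * (rho1 * x ^+ 4)).
    rewrite -[leLHS]mulrA; apply: ler_wpM2l => //.
    by apply: ler_pM => //; rewrite ?divr_ge0 ?sqr_ge0.
  by ring.
- rewrite complete_bipartiteE -/A -/B /subgraph /is_graph /= crossS //
  setUSS //.
  by rewrite cross_pairs // (disjointWl sA) // (disjointWr sB).
rewrite complete_bipartiteE -/A -/B; apply: le_trans (error_terms_le x1).
(* The last term of [error_terms_le] belongs to the degree scan and is discarded. *)
rewrite addrA ler_wpDr ?expR_ge0 //; apply: lerD.
  exact: (witness_scan_type1 q_gt0 q_lt1 M_gt0 M_n s_gt0 dAB sA sB cA' cB' s_ge).
apply: (@witness_scan_type2 _ _ _ s) => //; rewrite ?cA ?cB;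
  [exact: le_trans a_large|exact: le_trans b_large|
   exact: le_trans a_large|exact: le_trans b_large].
Qed.

Lemma witness_scan_strong_detection (a b Q : nat -> nat) :
  (forall n, (2 <= n)%N ->
     [/\ (1 <= a n)%N, (a n <= b n)%N & (a n + b n <= n)%N]) ->
  (\forall n \near \oo%classic,
     (b n)%:R <= rho * (a n)%:R /\ kappa * ln n%:R <= (a n)%:R) ->
  (\forall n \near \oo%classic,
     4 * kappa ^+ 2 * rho1 * (n%:R ^+ 2 / ((a n)%:R * (b n)%:R)) * ln n%:R ^+ 4
       <= (Q n)%:R) ->
  strong_detection_by_witness_scan q
    (fun n => complete_bipartite (a n) (b n)) Q.
Proof.
move=> abn ab_large Q_ge.
pose feasible n (Mh : nat * vegraph ('I_(a n) + 'I_(b n))%type) :=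
  [/\ (Mh.1 <= n)%N, ('C(Mh.1, 2) <= Q n)%N
    & subgraph Mh.2 (complete_bipartite (a n) (b n))].
pose ok n (Mh : nat * vegraph ('I_(a n) + 'I_(b n))%type) :=
  error_sum q (complete_bipartite (a n) (b n)) (witness_scan R n Mh.1 Mh.2) <=
  (9 + expR 1) / ln n%:R.
have ex n : exists Mh, feasible n Mh /\
    ((exists2 Mh', feasible n Mh' & ok n Mh') -> ok n Mh).
  case: (pselect (exists2 Mh', feasible n Mh' & ok n Mh')).
    by move=> [Mh' ? ?]; exists Mh'.
  (* An empty sample with the empty witness is always feasible. *)
  by move=> no; exists (0%N, (set0, set0)); split => //; split;
    rewrite // /subgraph /is_graph !sub0set.
pose Mh n := projT1 (cid (ex n)).
have feas n : feasible n (Mh n) by have [] := projT2 (cid (ex n)).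
exists (fun n => (Mh n).1), (fun n => (Mh n).2); split=> //.
apply: (@strongly_detects_of_bound _ _ (9 + expR 1)).
- by rewrite !ltW.
- by move=> n; have [Mn CM _] := feas n; apply: witness_scan_within_budget.
near=> n; have [_] := projT2 (cid (ex n)); apply.
have n2 : (2 <= n)%N by near: n; exact: nbhs_infty_ge.
have [a1 ab abn'] := abn n n2.
have [b_le a_ge] : (b n)%:R <= rho * (a n)%:R /\ kappa * ln n%:R <= (a n)%:R.
  by near: n.
have [||M [h [Mn CM hg err]]] :=
    witness_scan_detects (K := Q n) a1 ab abn' _ b_le a_ge.
- by near: n; apply: near_ln_ge.
- by near: n.
by exists (M, h).
Unshelve. all: by end_near.
Qed.

End WitnessScanDetects.

(** * Impossibility and the two detection regimes with explicit constants *)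

Local Open Scope classical_set_scope.
Local Open Scope ring_scope.

Theorem corollary9 (R : realType) (q : R) (q_gt0 : 0 < q) (q_lt1 : q < 1) :
  [/\ (forall (a b Q : nat -> nat),
        (forall n, (2 <= n)%N ->
           [/\ (1 <= a n)%N, (a n <= b n)%N & (a n + b n <= n)%N]) ->
        (fun n => (Q n)%:R : R) =o_\oo
          (fun n => n%:R ^+ 2 / ((a n)%:R * (b n)%:R) : R) ->
        weak_detection_impossible q
          (fun n => complete_bipartite (a n) (b n)) Q),
      (exists C1 C2 : R, [/\ 0 < C1, 0 < C2 &
        forall (a b Q : nat -> nat),
        (forall n, (2 <= n)%N ->
           [/\ (1 <= a n)%N, (a n <= b n)%N & (a n + b n <= n)%N]) ->
        (\forall n \near \oo,
           let m : R :=
             (Num.ceil (C1 * (n%:R ^+ 2 / (b n)%:R ^+ 2) * ln n%:R))%:~R in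
           m <= n%:R / 2 /\
           10 * ln n%:R <= ((a n)%:R + (b n)%:R) * m / n%:R) ->
        (\forall n \near \oo,
           C2 * (n%:R ^+ 3 / ((a n)%:R * (b n)%:R ^+ 2)) * ln n%:R ^+ 2
             <= (Q n)%:R) ->
        strong_detection_possible q
          (fun n => complete_bipartite (a n) (b n)) Q]) &
      (forall rho : R, exists C0 C3 : R, [/\ 0 < C0, 0 < C3 &
        forall (a b Q : nat -> nat),
        (forall n, (2 <= n)%N ->
           [/\ (1 <= a n)%N, (a n <= b n)%N & (a n + b n <= n)%N]) ->
        (\forall n \near \oo,
           (b n)%:R <= rho * (a n)%:R /\ C0 * ln n%:R <= (a n)%:R) ->
        (\forall n \near \oo,
           C3 * (n%:R ^+ 2 / ((a n)%:R * (b n)%:R)) * ln n%:R ^+ 4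
             <= (Q n)%:R) ->
        strong_detection_by_witness_scan q
          (fun n => complete_bipartite (a n) (b n)) Q])].
Proof.
have q01 : 0 <= q <= 1 by rewrite !ltW.
have q1 : 0 < 1 - q by rewrite subr_gt0.
split.
- by move=> a b Q; apply: bip_weak_detection_impossible.
- exists (256 / (1 - q) ^+ 2), (4 * (256 / (1 - q) ^+ 2)).
  have C_gt0 : 0 < 256 / (1 - q) ^+ 2 by rewrite divr_gt0 // exprn_gt0.
  split=> [//||a b Q abn m_le Q_ge]; first by rewrite mulr_gt0.
  apply: degree_scan_strong_detection => //.
  by apply: filterS m_le => n [].
- move=> rho.
  exists (2 * (3 / - ln q + 1)),
    (4 * (2 * (3 / - ln q + 1)) ^+ 2 * Num.max rho 1).
  have lam : 0 < - ln q by rewrite oppr_gt0 ln_lt0 // q_gt0.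
  have kappa_gt0 : 0 < 2 * (3 / - ln q + 1).
    by rewrite mulr_gt0 // addr_gt0 // divr_gt0.
  split=> // [|a b Q abn ab_large Q_ge].
    by rewrite mulr_gt0 ?lt_max ?ltr01 ?orbT // mulr_gt0 // exprn_gt0.
  exact: (witness_scan_strong_detection (rho := rho)).
Qed.
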